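(* Let $\dot A$ be a densely defined closed symmetric operator with deficiency indices $(1,1)$ in a Hilbert space $\mathcal H$, let $\mathcal H_+\subset\mathcal H\subset\mathcal H_-$ be the rigged Hilbert space generated by $\dot A$, let $g_\pm\in\operatorname{Ker}(\dot A^*\mp iI)$ be $(+)$-normalized deficiency vectors, $\|g_\pm\|_+=1$, and set $\varphi=\mathcal R^{-1}g_+$, $\psi=\mathcal R^{-1}g_-$, where $\mathcal R$ is the Riesz-Berezansky operator. Let $\alpha\in[0,\pi)$ and suppose that $A_\alpha$ is the self-adjoint extension of $\dot A$ such that $g_+-e^{2i\alpha}g_-\in\mathrm{Dom}(A_\alpha)$. Then the Weyl-Titchmarsh function $M_{(\dot A,A_\alpha)}(z)$ of the pair $(\dot A,A_\alpha)$ coincides with the impedance function of a unique L-system of the form $$\Theta_{\alpha0}=\begin{pmatrix}\mathbb A_{\alpha0}&K_{\alpha0}&1\\ \mathcal H_+\subset\mathcal H\subset\mathcal H_-&&\mathbb C\end{pmatrix},$$ where $$\mathbb A_{\alpha0}=\dot A^*-i(\cdot,\psi)(e^{-2i\alpha}\varphi-\psi),\qquad K_{\alpha0}c=c\cdot\chi_{\alpha0}\ (c\in\mathbb C),\qquad \chi_{\alpha0}=\tfrac1{\sqrt2}(\varphi-e^{2i\alpha}\psi).$$ In this case the von Neumann parameter $\kappa$ of the main operator $T_{\alpha0}$ of $\Theta_{\alpha0}$ and the von Neumann parameter $U$ of the quasi-kernel $\hat A_{\alpha0}=A_\alpha$ of $\mathrm{Re}\,\mathbb A_{\alpha0}$ are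 $$\kappa=0\quad\text{and}\quad U=-e^{2i\alpha}.$$ Moreover, if $\Theta$ is an L-system with state-space operator $\mathbb A$, main operator $T$ and symmetric operator $\dot A$ such that $V_\Theta(z)=M_{(\dot A,A_\alpha)}(z)$ for $z\in\mathbb C_+$, where $A_\alpha=\hat A$ is the quasi-kernel of $\mathrm{Re}\,\mathbb A$, then the von Neumann parameters $\kappa$ of $T$ and $U$ of $\hat A$ are $\kappa=0$ and $U=-e^{2i\alpha}$.
   Context: Inner products are linear in the first argument. $\mathbb C_\pm$ are the open upper and lower half-planes. Rigged space. For a closed densely defined symmetric $\dot A$ in $\mathcal H$, $\mathcal H_+=\mathrm{Dom}(\dot A^* )$ with $(f,g)_+=(f,g)+(\dot A^*f,\dot A^*g)$, and $\mathcal H_-$ is the corresponding negative space (dual of $\mathcal H_+$ with respect to the pairing extending the inner product of $\mathcal H$, also written $(\cdot,\cdot)$), so $\mathcal H_+\subset\mathcal H\subset\mathcal H_-$. The Riesz-Berezansky operator $\mathcal R$ is the isometric (linear) map of $\mathcal H_-$ onto $\mathcal H_+$ with $(f,g)=(f,\mathcal Rg)_+$ for $f\in\mathcal H_+$, $g\in\mathcal H_-$. $[\mathcal H_1,\mathcal H_2]$ denotes bounded linear operators. For $\mathbb A\in[\mathcal H_+,\mathcal H_-]$ the adjoint $\mathbb A^*\in[\mathcal H_+,\mathcal H_-]$ is taken with respect to the pairing; $\mathrm{Re}\,\mathbb A=\frac12(\mathbb A+\mathbb A^* )$, $\mathrm{Im}\,\mathbb A=\frac1{2i}(\mathbb A-\mathbb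 A^* )$. For $u,v\in\mathcal H_-$, $(\cdot,u)v$ denotes the operator $f\mapsto(f,u)v$ from $\mathcal H_+$ to $\mathcal H_-$. Extensions. A quasi-self-adjoint extension of $\dot A$ is a non-symmetric operator $T$ in $\mathcal H$ with $\dot A\subset T\subset\dot A^*$. A self-adjoint bi-extension of $\dot A$ is $\mathbb B\in[\mathcal H_+,\mathcal H_-]$ with $\dot A\subset\mathbb B=\mathbb B^*$; its quasi-kernel is the restriction of $\mathbb B$ to $\{f\in\mathcal H_+:\mathbb Bf\in\mathcal H\}$; it is t-self-adjoint if its quasi-kernel is self-adjoint in $\mathcal H$. If $T$ is a quasi-self-adjoint extension of $\dot A$ with $\rho(T)\neq\emptyset$, a $( * )$-extension of $T$ is $\mathbb A\in[\mathcal H_+,\mathcal H_-]$ with $\mathbb A\supset T\supset\dot A$, $\mathbb A^*\supset T^*\supset\dot A$ and $\mathrm{Re}\,\mathbb A$ a t-self-adjoint bi-extension of $\dot A$. L-system. An array $\Theta=\begin{pmatrix}\mathbb A&K&1\\ \mathcal H_+\subset\mathcal H\subset\mathcal H_-&&\mathbb C\end{pmatrix}$ is an L-system if (1) $T$ is a dissipative ($\mathrm{Im}(Tf,f)\ge0$, $f\in\mathrm{Dom}(T)$) quasi-self-adjoint extension, with $\rho(T)\ne\emptyset$, of a symmetric operator $\dot A$ with deficiency indices $(1,1)$; (2) $\mathbb A$ is a $( * )$-extension of $T$; (3) $\mathrm{Im}\,\mathbb A=KK^*$ with $K\in[\mathbb C,\mathcal H_-]$, $K^*\in[\mathcal H_+,\mathbb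 C]$. Here $\dot A$, $T$, $\mathbb A$, $K$ are the symmetric, main, state-space and channel operators. Its impedance function is $V_\Theta(z)=K^*(\mathrm{Re}\,\mathbb A-zI)^{-1}K$ for nonreal $z\in\rho(T)$, extended analytically to all of $\mathbb C_\pm$. von Neumann parameters (with respect to the given $g_\pm$). For a dissipative quasi-self-adjoint extension $T$: the number $\kappa$, $|\kappa|<1$, with $g_+-\kappa g_-\in\mathrm{Dom}(T)$. For a self-adjoint extension $\hat A$: the number $U$, $|U|=1$, with $g_++Ug_-\in\mathrm{Dom}(\hat A)$. Weyl-Titchmarsh function: for a self-adjoint extension $A$ of $\dot A$, $M_{(\dot A,A)}(z)=((Az+I)(A-zI)^{-1}g,g)$, $z\in\mathbb C_+$, where $g\in\operatorname{Ker}(\dot A^*-iI)$ has $\|g\|=1$ in the norm of $\mathcal H$ (e.g. $g=\sqrt2\,g_+$ for $(+)$-normalized $g_+$). *)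

(* Defs.v *)
(* MathComp-Analysis over an abstract realType R; the scalars are the complex
   numbers R[i] of mathcomp-real-closed. *)
From HB Require Import structures.
From mathcomp Require Import all_boot all_order all_algebra.
From mathcomp Require Import complex.
From mathcomp Require Import all_classical all_reals all_analysis.
Set Implicit Arguments.
Unset Strict Implicit.
Unset Printing Implicit Defensive.
Import Order.TTheory GRing.Theory Num.Theory numFieldNormedType.Exports.
Local Open Scope classical_set_scope.
Local Open Scope ring_scope.

(* A {dot H for conj} is linear in its first argument.  Norms, as everywhere
   below, take their values in (the nonnegative real part of) R[i]. *)
HB.mixin Record isHilbert (R : realType) H of CompleteNormedModule R[i] H := {
  inner : {dot H for (@Num.conj R[i])};
  innerff : forall f : H, inner f f = `|f| ^+ 2 }.
#[short(type="hilbertType")]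
HB.structure Definition Hilbert (R : realType) :=
  {H of isHilbert R H & CompleteNormedModule R[i] H}.

(* e^{it} *)
Definition expi (R : realType) (t : R) : R[i] := Complex (cos t) (sin t).

Section InnerTheory.
Context {R : realType} {H : hilbertType R}.
Implicit Types f g h : H.

Lemma inner_conj f g : inner g f = (inner f g)^*.
Proof. by rewrite hermC /= mul1r. Qed.

Lemma innerPl (a : R[i]) f g h :
  inner (a *: f + g) h = a * inner f h + inner g h.
Proof. by rewrite linearDl linearZl_LR. Qed.

Lemma innerPr (a : R[i]) f g h :
  inner h (a *: f + g) = a^* * inner h f + inner h g.
Proof. by rewrite linearDr linearZr_LR. Qed.

Lemma CauchySchwarz_inner f g : `|inner f g| <= `|f| * `|g|.
Proof.
have [->|g0] := eqVneq g 0; first by rewrite linear0r !normr0 mulr0.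
have ng : 0 < `|g| ^+ 2 by rewrite exprn_gt0 // normr_gt0.
set a := inner f g.
rewrite -(@ler_pXn2r _ 2) ?nnegrE ?mulr_ge0 // exprMn -ler_pdivrMr //.
set c := a / `|g| ^+ 2; have := exprn_ge0 2 (normr_ge0 (- c *: g + f)).
rewrite -innerff innerPl !innerPr (inner_conj f g) -/a !innerff.
have cN : c^* * `|g| ^+ 2 = a^*.
  rewrite /c rmorphM /= fmorphV /= (geC0_conj (ltW ng)) divfK // gt_eqF //.
rewrite rmorphN !mulNr cN addNr mulr0 oppr0 add0r addrC subr_ge0.
rewrite -(ler_pM2r ng) mulrAC cN ler_pdivrMr //.
by rewrite normCK [a * _]mulrC.
Qed.

End InnerTheory.

(* An operator in H is its graph, so that [`<=`] is extension of operators and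
   [=] is equality of domains and values. *)
Notation operator H := (set (H * H)%type).

Section UnboundedOperators.
Context {R : realType} {H : hilbertType R}.
Implicit Types (T A : operator H) (z : R[i]).

Definition is_operator T : Prop :=
  [/\ T 0, (forall (a : R[i]) u v, T u -> T v -> T (a *: u + v)) &
      (forall f h k, T (f, h) -> T (f, k) -> h = k)].

Definition dom T : set H := [set f | exists h, T (f, h)].

Definition app T (f : H) : H := xget 0 [set h | T (f, h)].

(* Single-valued exactly when T is densely defined. *)
Definition adj T : operator H :=
  [set gh | forall f k, T (f, k) -> inner k gh.1 = inner f gh.2].

Definition symmetric_op T : Prop :=
  forall f h g k, T (f, h) -> T (g, k) -> inner h g = inner f k.

Definition self_adjoint T : Prop :=
  [/\ is_operator T, dense (dom T) & adj T = T].

Definition dissipative T : Prop :=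
  forall f h, T (f, h) -> 0 <= 'Im (inner h f).

Definition ker_shift T z : set H := [set f | T (f, z *: f)].

Definition one_dimensional (S : set H) : Prop :=
  exists2 g, g != 0 & S = range (fun c : R[i] => c *: g).

Definition deficiency_indices_11 T : Prop :=
  one_dimensional (ker_shift (adj T) 'i) /\
  one_dimensional (ker_shift (adj T) (- 'i)).

Definition symmetric_11 A : Prop :=
  [/\ is_operator A, closed A, dense (dom A), symmetric_op A &
      deficiency_indices_11 A].

Definition resolvent_set T : set R[i] :=
  [set z | (forall g, exists f h, T (f, h) /\ h - z *: f = g) /\
           exists M : R[i],
             forall f h, T (f, h) -> `|f| <= M * `|h - z *: f| ].

Definition resolvent T z (g : H) : H :=
  xget 0 [set f | exists2 h, T (f, h) & h - z *: f = g].

Definition quasi_self_adjoint_ext A T : Prop :=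
  [/\ is_operator T, A `<=` T, T `<=` adj A & ~ symmetric_op T].

Definition self_adjoint_ext A T : Prop := A `<=` T /\ self_adjoint T.

(* M_{(A0, A)}(z), for a unit vector g of Ker(A0^* - iI) *)
Definition weyl_titchmarsh A (g : H) z : R[i] :=
  let f := resolvent A z g in inner (z *: app A f + f) g.

Definition vonNeumann_kappa (gp gm : H) T (kappa : R[i]) : Prop :=
  `|kappa| < 1 /\ dom T (gp - kappa *: gm).

Definition vonNeumann_U (gp gm : H) A (U : R[i]) : Prop :=
  `|U| = 1 /\ dom A (gp + U *: gm).

End UnboundedOperators.

Section RiggedSpace.
Context {R : realType} {H : hilbertType R} (A : operator H).

Definition hplus_pred : {pred H} := mem (dom (adj A)).

Record hplus := HPlus { hplus_val :> H; hplusP : hplus_val \in hplus_pred }.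
HB.instance Definition _ := [isSub for hplus_val].
HB.instance Definition _ := [Choice of hplus by <:].

Lemma hplus_submod_closed : submod_closed hplus_pred.
Proof.
split=> [|a f g]; rewrite !inE.
  by exists 0 => f k _ /=; rewrite !linear0r.
move=> [h fh] [k gk]; exists (a *: h + k) => u v uv /=.
by rewrite !innerPr (fh _ _ uv) (gk _ _ uv).
Qed.
HB.instance Definition _ := GRing.isSubmodClosed.Build _ _ hplus_pred
  hplus_submod_closed.
HB.instance Definition _ := [SubChoice_isSubLmodule of hplus by <:].

Definition Astar (f : hplus) : H := app (adj A) f.

Definition inner_plus (f g : hplus) : R[i] :=
  inner (f : H) (g : H) + inner (Astar f) (Astar g).

Definition norm_plus (f : hplus) : R[i] := sqrtC (inner_plus f f).

Lemma inner_plus_ge0 f : 0 <= inner_plus f f.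
Proof. by rewrite /inner_plus !innerff addr_ge0 // exprn_ge0. Qed.

Lemma norm_plus_ge0 f : 0 <= norm_plus f.
Proof. by rewrite sqrtC_ge0 inner_plus_ge0. Qed.

Lemma norm_le_plus (f : hplus) : `|f : H| <= norm_plus f.
Proof.
rewrite -(@ler_pXn2r _ 2) ?nnegrE ?norm_plus_ge0 // sqrtCK /inner_plus.
by rewrite !innerff lerDl exprn_ge0.
Qed.

(* H_- is the space of bounded antilinear functionals on H_+, the functional
   [u] being f |-> (u, f); thus the pairing (f, u) is [(u f)^*]. *)
Definition hminus_pred : {pred hplus -> R[i]} :=
  mem [set u : hplus -> R[i] |
        (forall (a : R[i]) f g, u (a *: f + g) = a^* * u f + u g) /\
        exists M : R[i], forall f, `|u f| <= M * norm_plus f].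

Record hminus :=
  HMinus { hminus_val :> hplus -> R[i]; hminusP : hminus_val \in hminus_pred }.
HB.instance Definition _ := [isSub for hminus_val].
HB.instance Definition _ := [Choice of hminus by <:].

Lemma hminus_submod_closed : submod_closed hminus_pred.
Proof.
split=> [|a u v]; rewrite !inE /=.
  split=> [b f g|]; first by rewrite mulr0 addr0.
  by exists 0 => f; rewrite mul0r normr0.
move=> [uP [M uM]] [vP [N vN]]; split=> [b f g|].
  change (a * u (b *: f + g) + v (b *: f + g) =
    b^* * (a * u f + v f) + (a * u g + v g)).
  by rewrite uP vP !mulrDr mulrCA addrACA.
exists (`|a| * M + N) => f; rewrite mulrDl -mulrA.
apply: le_trans (ler_normD _ _) _; apply: lerD; last exact: vN.
change (`|a * u f| <= `|a| * (M * norm_plus f)).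
by rewrite normrM ler_wpM2l.
Qed.
HB.instance Definition _ := GRing.isSubmodClosed.Build _ _ hminus_pred
  hminus_submod_closed.
HB.instance Definition _ := [SubChoice_isSubLmodule of hminus by <:].

Definition pairing (f : hplus) (u : hminus) : R[i] := (u f)^*.

Lemma emb_subproof (h : H) : (fun f : hplus => inner h (f : H)) \in hminus_pred.
Proof.
rewrite inE; split=> [a f g|]; first by rewrite innerPr.
exists `|h| => f; apply: le_trans (CauchySchwarz_inner _ _) _.
by rewrite ler_wpM2l // norm_le_plus.
Qed.

(* the inclusion of H into H_- *)
Definition emb (h : H) : hminus := HMinus (emb_subproof h).

Lemma pairing_emb (f : hplus) h : pairing f (emb h) = inner (f : H) h.
Proof. by rewrite /pairing /= -inner_conj. Qed.

Definition riesz_berezansky (u : hminus) : hplus :=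
  xget 0 [set g | forall f, pairing f u = inner_plus f g].

(* [H_+, H_-]; the bound says that the H_- norm of [B f] is at most
   [M * norm_plus f]. *)
Definition bop_pred : {pred hplus -> hminus} :=
  mem [set B : hplus -> hminus | linear B /\
        exists M : R[i],
          forall f g, `|B f g| <= M * norm_plus f * norm_plus g].

Record bop := BOp { bop_val :> hplus -> hminus; bopP : bop_val \in bop_pred }.
HB.instance Definition _ := [isSub for bop_val].
HB.instance Definition _ := [Choice of bop by <:].

Lemma bop_submod_closed : submod_closed bop_pred.
Proof.
split=> [|a B C]; rewrite !inE /=.
  split=> [b f g|]; first by rewrite /GRing.zero/= scaler0 addr0.
  by exists 0 => f g; rewrite !mul0r normr0.
move=> [BP [M BM]] [CP [N CN]]; split=> [b f g|].
  change (a *: B (b *: f + g) + C (b *: f + g) =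
    b *: (a *: B f + C f) + (a *: B g + C g)).
  by rewrite BP CP !scalerDr !scalerA [a * b]mulrC addrACA.
exists (`|a| * M + N) => f g; rewrite !mulrDl -!mulrA.
apply: le_trans (ler_normD _ _) _; apply: lerD; last by rewrite mulrA; exact: CN.
change (`|a * B f g| <= `|a| * (M * (norm_plus f * norm_plus g))).
by rewrite normrM ler_wpM2l // mulrA.
Qed.
HB.instance Definition _ := GRing.isSubmodClosed.Build _ _ bop_pred
  bop_submod_closed.
HB.instance Definition _ := [SubChoice_isSubLmodule of bop by <:].

Lemma bop_linear (B : bop) : linear B.
Proof. by case: B => B /= /[!inE] -[]. Qed.

Lemma badj_val_subproof (B : bop) (g : hplus) :
  (fun f => pairing g (B f)) \in hminus_pred.
Proof.
rewrite inE; split=> [a f f'|].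
  rewrite /pairing bop_linear.
  change ((a * B f g + B f' g)^* = a^* * (B f g)^* + (B f' g)^*).
  by rewrite rmorphD rmorphM.
case: B => B /= /[!inE] -[_ [M BM]]; exists (M * norm_plus g) => f.
by rewrite /pairing norm_conjC mulrAC; exact: BM.
Qed.

Definition badj_val (B : bop) (g : hplus) : hminus :=
  HMinus (badj_val_subproof B g).

Lemma badj_subproof (B : bop) : badj_val B \in bop_pred.
Proof.
rewrite inE; split=> [a f g|].
  apply/val_inj/funext => h; have := hminusP (B h); rewrite inE => -[Bh _].
  change ((B h (a *: f + g))^* = a * (B h f)^* + (B h g)^*).
  by rewrite Bh rmorphD rmorphM /= conjCK.
case: B => B /= /[!inE] -[_ [M BM]]; exists M => f g.
by rewrite /pairing norm_conjC mulrAC; exact: BM.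
Qed.

(* B^* with respect to the pairing *)
Definition badj (B : bop) : bop := BOp (badj_subproof B).

Lemma badjP (B : bop) f g : B f g = pairing f (badj B g).
Proof. by rewrite /pairing /= /pairing conjCK. Qed.

Definition bRe (B : bop) : bop := 2^-1 *: (B + badj B).
Definition bIm (B : bop) : bop := (2 * 'i)^-1 *: (B - badj B).

(* The restriction of B to {f | B f in H}, as an operator in H; in particular
   the inclusion of an operator T in B is [T `<=` quasi_kernel B]. *)
Definition quasi_kernel (B : bop) : operator H :=
  [set fh | exists2 f : hplus, (f : H) = fh.1 & B f = emb fh.2].

Definition self_adjoint_biext (B : bop) : Prop :=
  A `<=` quasi_kernel B /\ badj B = B.

Definition t_self_adjoint_biext (B : bop) : Prop :=
  self_adjoint_biext B /\ self_adjoint (quasi_kernel B).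

Definition star_extension (T : operator H) (B : bop) : Prop :=
  [/\ T `<=` quasi_kernel B, A `<=` T,
      adj T `<=` quasi_kernel (badj B), A `<=` adj T &
      t_self_adjoint_biext (bRe B)].

(* [C, H_-] *)
Definition is_channel (K : R[i] -> hminus) : Prop :=
  (forall a c d : R[i], K (a * c + d) = a *: K c + K d) /\
  exists M : R[i], forall c f, `|K c f| <= M * `|c| * norm_plus f.

(* K^*, i.e. (K c, f) = c (K^* f)^*; see channel_adjP *)
Definition channel_adj (K : R[i] -> hminus) (f : hplus) : R[i] :=
  pairing f (K 1).

Lemma channel_adjP K c f : is_channel K -> K c f = c * (channel_adj K f)^*.
Proof.
move=> [KP _]; have /(congr1 val) K0 : K 0 = 0.
  by have := KP (-1) 0 0; rewrite mulr0 addr0 scaleN1r addNr.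
rewrite -[c in LHS]mulr1 -[X in K X]addr0 KP.
change (c * K 1 f + K 0 f = c * (channel_adj K f)^*).
rewrite /channel_adj /pairing conjCK.
by rewrite (_ : K 0 f = 0) ?addr0 //; exact: (congr1 (fun u => u f) K0).
Qed.

Record L_system := LSystem {
  main_op : operator H;
  state_op : bop;
  channel_op : R[i] -> hminus;
  L_symmetric : symmetric_11 A;
  L_main : quasi_self_adjoint_ext A main_op;
  L_dissipative : dissipative main_op;
  L_resolvent : resolvent_set main_op !=set0;
  L_state : star_extension main_op state_op;
  L_channel : is_channel channel_op;
  L_Im : forall f, bIm state_op f = channel_op (channel_adj channel_op f) }.

(* V(z) = K^* (Re AA - z I)^{-1} K, as a number.  For an L-system the equation
   below has exactly one solution for every nonreal z, inside or outside the
   resolvent set of the main operator, so that the formula itself provides the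
   analytic extension to both half-planes. *)
Definition impedance (Th : L_system) (z : R[i]) : R[i] :=
  channel_adj (channel_op Th)
    (xget 0 [set f : hplus |
      bRe (state_op Th) f - z *: emb (f : H) = channel_op Th 1]).

(* AA = A^* - i (., psi) (e^{-2i alpha} phi - psi) and
   K c = c (phi - e^{2i alpha} psi) / sqrt 2 *)
Definition has_form_alpha0 (alpha : R) (phi psi : hminus) (Th : L_system) :
    Prop :=
  (forall f, state_op Th f = emb (Astar f)
     - ('i * pairing f psi) *: (expi (- (2 * alpha)) *: phi - psi)) /\
  (forall c, channel_op Th c =
     c *: ((sqrtC 2)^-1 *: (phi - expi (2 * alpha) *: psi))).

End RiggedSpace.

(* Main.v *)
(* Write x f = (f, g_+)_+, y f = (f, g_-)_+, e = e^{2 i alpha} and e^* for its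
   conjugate.  By von Neumann's (+)-orthogonal decomposition
   Dom A^* = Dom A + span g_+ + span g_-, an
   operator between A and A^* is given by a linear condition on (x, y), and
     (A^* f, h) - (f, A^* h) = i (x f conj(x h) - y f conj(y h)).
   The stated AA has Re AA = A^* - (i/2) (x + e^* y) (phi - e psi) and
   Im AA = (1/2) (x - e^* y) (phi - e psi), so that A_alpha is the line
   x + e^* y = 0 and the main operator is the line y = 0.  With
   r = (A_alpha - z)^{-1} g, the vector g + (z - i) r lies in Ker (A^* - z); up
   to a factor it solves the equation defining V(z), whence
   V(z) = z + (z^2 + 1) (r, g) = M(z).

   Conversely, once the quasi-kernel of Re AA is A_alpha, Re AA - A^* has the
   form (x + e^* y) v, and Hermiticity leaves one real parameter free in v.  The
   single value V(i) = M(i) = i fixes this parameter and, up to a unimodular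
   factor, the channel vector; so AA is the operator above and y = 0 on
   Dom T. *)
Require Import Defs.
From HB Require Import structures.
From mathcomp Require Import all_boot all_order all_algebra.
From mathcomp Require Import complex.
From mathcomp Require Import all_classical all_reals all_analysis.
From mathcomp Require Import ring.
Set Implicit Arguments.
Unset Strict Implicit.
Unset Printing Implicit Defensive.
Import Order.TTheory GRing.Theory Num.Theory numFieldNormedType.Exports.
Local Open Scope classical_set_scope.
Local Open Scope ring_scope.

(** * Infima and small positive numbers in the partially ordered field [R[i]] *)

(** Nonnegative elements of [R[i]] are real, so the infimum of the real parts serves. *)
Lemma complex_inf (R : realType) (E : set R[i]) :
    E !=set0 -> (forall e, E e -> 0 <= e) ->
  exists2 d, (forall e, E e -> d <= e) &
             (forall eps, 0 < eps -> exists2 e, E e & e < d + eps).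
Proof.
move=> [e0 Ee0] E_ge0; pose F := [set complex.Re e | e in E].
have ReK (e : R[i]) : 0 <= e -> (complex.Re e)%:C%C = e.
  by move=> /ger0_real /RRe_real.
have F_inf : has_inf F.
  split; first by exists (complex.Re e0), e0.
  by exists 0 => _ [e /E_ge0 /[!lecE] /andP[_ ?] <-].
exists (inf F)%:C%C => [e Ee|eps eps_gt0].
  rewrite -(ReK e) ?E_ge0 // lecR; apply: ge_inf; first exact: F_inf.2.
  by exists e.
have eps_real := ReK _ (ltW eps_gt0).
have /(inf_adherent)/(_ F_inf)[_ [e Ee <-] e_lt] : 0 < complex.Re eps.
  by rewrite -ltcR eps_real.
by exists e => //; rewrite -(ReK e) ?E_ge0 // -eps_real -rmorphD ltcR.
Qed.

Lemma near_invSn_lt (R : realType) (eps : R[i]) :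
  0 < eps -> \forall n \near \oo, n.+1%:R^-1 < eps.
Proof.
move=> eps_gt0; have epsE := RRe_real (gtr0_real eps_gt0).
have Re_gt0 : 0 < complex.Re eps by rewrite -ltcR epsE.
near=> n; rewrite -epsE -[n.+1%:R](rmorph_nat (real_complex R)) -fmorphV ltcR.
by near: n; exact: near_infty_natSinv_lt (PosNum Re_gt0).
Unshelve. all: by end_near. Qed.

(** * Orthogonal projection *)

Section HilbertSpace.
Context {R : realType} {H : hilbertType R}.
Implicit Types (f g h x y s t : H) (z : R[i]).

Lemma cauchy_seq_cvg (u : nat -> H) :
    (forall eps : R[i], 0 < eps -> exists N : nat, forall m n : nat,
       (N <= m)%N -> (N <= n)%N -> `|u m - u n| < eps) ->
  exists l : H, u @ \oo --> l.
Proof.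
move=> cauchy_u; apply/cvg_ex/cauchy_cvgP/cauchy_exP => eps eps_gt0.
have [N uN] := cauchy_u _ eps_gt0; exists (u N).
exists N => // n /= Nn; rewrite -ball_normE /=; exact: uN.
Qed.

Lemma cvg_cauchy_seq (u : nat -> H) (l : H) : u @ \oo --> l ->
  forall eps : R[i], 0 < eps -> exists N : nat, forall m n : nat,
    (N <= m)%N -> (N <= n)%N -> `|u m - u n| < eps.
Proof.
move=> /cvgrPdist_lt ul eps eps_gt0.
have [|N _ uN] := ul (eps / 2); first by rewrite divr_gt0.
exists N => m n Nm Nn; rewrite -(subrKA l) [X in _ < X]splitr.
apply: le_lt_trans (ler_normD _ _) _.
by rewrite [X in X + _]distrC ltrD // uN.
Qed.

Lemma innerBl f g h : inner (f - g) h = inner f h - inner g h.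
Proof. by rewrite linearBl. Qed.

Lemma innerBr f g h : inner h (f - g) = inner h f - inner h g.
Proof. by rewrite linearBr. Qed.

Lemma innerDl f g h : inner (f + g) h = inner f h + inner g h.
Proof. by rewrite linearDl. Qed.

Lemma innerZl z f h : inner (z *: f) h = z * inner f h.
Proof. by rewrite linearZl_LR. Qed.

Lemma innerZr z f h : inner h (z *: f) = z^* * inner h f.
Proof. by rewrite linearZr_LR. Qed.

Lemma inner_eq0 f : inner f f = 0 -> f = 0.
Proof. by rewrite innerff => /eqP; rewrite sqrf_eq0 normr_eq0 => /eqP. Qed.

(** For f nonzero, a point g of D closer to f than |f| would give |f|^2 = |(f, f - g)| <= |f| |f -
    g| < |f|^2. *)
Lemma inner_dense_eq0 (D : set H) f :
  dense D -> (forall g, D g -> inner f g = 0) -> f = 0.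
Proof.
move=> D_dense fD; apply/eqP/negPn/negP => f0.
have nf : 0 < `|f| by rewrite normr_gt0.
have [|g [fg Dg]] := D_dense _ _ (@ball_open _ _ f `|f|).
  by exists f; exact: ballxx.
have : `|inner f (f - g)| <= `|f| * `|f - g| by exact: CauchySchwarz_inner.
rewrite innerBr (fD g) // subr0 innerff normrX normr_id expr2 ler_pM2l //.
by move: fg; rewrite -ball_normE /= => /lt_geF ->.
Qed.

(* The minimising sequence is almost orthogonal to S, which makes it Cauchy
   without the parallelogram law. *)
Lemma orthogonal_projection (S : set H) x : S 0 ->
    (forall z s t, S s -> S t -> S (z *: s + t)) ->
    (forall (u : nat -> H) (l : H),
       (forall n, S (u n)) -> u @ \oo --> l -> S l) ->
  exists2 s, S s & forall t, S t -> inner (x - s) t = 0.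
Proof.
move=> S0 S_lin S_closed.
have [||d d_le d_glb] := @complex_inf R [set `|x - s| ^+ 2 | s in S].
- by exists (`|x - 0| ^+ 2), 0.
- by move=> _ [s _ <-]; exact: exprn_ge0.
pose eta n : R[i] := n.+1%:R^-1.
have eta_gt0 n : 0 < eta n by rewrite invr_gt0.
have almost_orth n : exists s, S s /\
    forall t, S t -> `|inner (x - s) t| <= eta n * `|t|.
  (* The tolerance is squared because the comparison below bounds [|a| ^+ 2 / N]. *)
  have [|_ [s Ss <-] s_min] := d_glb (eta n ^+ 2); first by rewrite exprn_gt0.
  exists s; split=> // t St.
  have [->|t0] := eqVneq t 0; first by rewrite linear0r !normr0 mulr0.
  set a := inner (x - s) t; pose N := `|t| ^+ 2.
  have N_gt0 : 0 < N by rewrite exprn_gt0 ?normr_gt0.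
  (* Moving s by the projection of x - s on t lowers the squared distance by |a|^2 / N, which
     therefore stays below the tolerance. *)
  have : d <= `|x - s - (a / N) *: t| ^+ 2.
    apply: d_le; exists ((a / N) *: t + s); first exact: S_lin.
    by rewrite opprD addrCA addrC.
  have -> : `|x - s - (a / N) *: t| ^+ 2 = `|x - s| ^+ 2 - `|a| ^+ 2 / N.
    rewrite /a; move: (x - s) => f.
    rewrite -!innerff innerBl !innerBr !innerZl !innerZr.
    rewrite (inner_conj f t) (innerff t) -/N normCK rmorphM /= fmorphV /=.
    rewrite (geC0_conj (ltW N_gt0)) divfK ?gt_eqF // subrr subr0; congr (_ - _).
    by rewrite mulrC mulrA.
  rewrite lerBrDr => /le_lt_trans/(_ s_min).
  rewrite ltrD2l ltr_pdivrMr // -exprMn => /ltW.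
  by rewrite ler_pXn2r // nnegrE ?mulr_ge0 // ltW.
have [u uP] := choice almost_orth.
have Su n : S (u n) by have [] := uP n.
have dist_u m n : `|u m - u n| <= eta m + eta n.
  have [->|umn] := eqVneq (u m - u n) 0; first by rewrite normr0 addr_ge0 ?ltW.
  have S_umn : S (u m - u n) by rewrite -scaleN1r addrC; exact: S_lin.
  have um_gt0 : 0 < `|u m - u n| by rewrite normr_gt0.
  rewrite -(ler_pM2r um_gt0) -expr2 mulrDl.
  rewrite -[leLHS]ger0_norm ?exprn_ge0 // -innerff.
  (* As u_m - u_n lies in S, its squared norm is a difference of two products that almost
     orthogonality makes small. *)
  have -> : inner (u m - u n) (u m - u n) =
      inner (x - u n) (u m - u n) - inner (x - u m) (u m - u n).
    by rewrite -innerBl opprB [X in _ = inner X _]addrC subrKA.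
  apply: le_trans (ler_normB _ _) _.
  by rewrite addrC lerD // (proj2 (uP _)).
have [|s us] := @cauchy_seq_cvg u.
  move=> e e_gt0; have [|N _ etaN] := @near_invSn_lt R (e / 2).
    by rewrite divr_gt0.
  exists N => m n Nm Nn; apply: le_lt_trans (dist_u m n) _.
  by rewrite [ltRHS]splitr ltrD // etaN.
exists s; first exact: S_closed us.
move=> t St; apply/eqP; rewrite -normr_le0; apply/ler_addgt0Pr => e e_gt0.
rewrite add0r.
have t1_gt0 : 0 < 1 + `|t| by rewrite ltr_pwDl.
have d_gt0 : 0 < e / (1 + `|t|) / 2 by rewrite !divr_gt0.
near \oo => n.
have -> : inner (x - s) t = inner (x - u n) t - inner (s - u n) t.
  by rewrite -innerBl opprB addrA subrK.
apply: le_trans (ler_normB _ _) _.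
apply: (@le_trans _ _ (e / (1 + `|t|) / 2 * `|t| + e / (1 + `|t|) / 2 * `|t|)).
  apply: lerD.
    apply: le_trans (proj2 (uP n) _ St) _; rewrite ler_wpM2r // ltW //.
    by near: n; exact: near_invSn_lt.
  apply: le_trans (CauchySchwarz_inner _ _) _; rewrite ler_wpM2r // ltW //.
  by near: n; move/cvgrPdist_lt : us; exact.
rewrite -mulrDl -splitr mulrAC ler_pdivrMr // ler_wpM2l ?ltW //.
by rewrite ltrDr.
Unshelve. all: by end_near. Qed.
End HilbertSpace.

(** * Ranges of shifted symmetric operators *)

Definition seq_closed (R : realType) (H : hilbertType R) (T : operator H) :
    Prop :=
  forall (u v : nat -> H) (f h : H), (forall n, T (u n, v n)) ->
    u @ \oo --> f -> v @ \oo --> h -> T (f, h).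

Section Operators.
Context {R : realType} {H : hilbertType R}.
Implicit Types (T A : operator H) (f g h k x : H) (z : R[i]).

Lemma cvg_innerr k (u : nat -> H) (l : H) :
  u @ \oo --> l -> inner k (u n) @[n --> \oo] --> inner k l.
Proof.
move=> /cvgrPdist_lt ul; apply/cvgrPdist_lt => e e_gt0.
have k1_gt0 : 0 < 1 + `|k| by rewrite ltr_pwDl.
near=> n; rewrite -innerBr; apply: le_lt_trans (CauchySchwarz_inner _ _) _.
apply: (@le_lt_trans _ _ ((1 + `|k|) * `|l - u n|)).
  by rewrite ler_wpM2r // lerDr.
rewrite mulrC -ltr_pdivlMr //; near: n; apply: ul; exact: divr_gt0.
Unshelve. all: by end_near. Qed.

Lemma adj_seq_closed T : seq_closed (adj T).
Proof.
move=> u v f h uv uf vh a b Tab /=.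
have := cvg_innerr (k := b) uf.
under eq_fun do rewrite (uv _ _ _ Tab) /=.
by move=> /cvg_unique; apply; [exact: norm_hausdorff|exact: cvg_innerr].
Qed.

Lemma closed_seq_closed T : closed T -> seq_closed T.
Proof.
move=> clT u v f h uv uf vh.
apply: (closed_cvg T clT (u_ := fun n => (u n, v n)) (F := \oo)).
  by near=> n; exact: uv.
exact: cvg_pair.
Unshelve. all: by end_near. Qed.

Lemma adj_lin T z f h g k :
  adj T (f, h) -> adj T (g, k) -> adj T (z *: f + g, z *: h + k).
Proof.
move=> fh gk a b Tab /=.
by rewrite !innerPr (fh _ _ Tab) (gk _ _ Tab).
Qed.

Lemma adj_uniq T f h k : dense (dom T) -> adj T (f, h) -> adj T (f, k) -> h = k.
Proof.
move=> T_dense fh fk; apply/eqP; rewrite -subr_eq0; apply/eqP.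
apply: (inner_dense_eq0 T_dense) => g [l Tgl].
rewrite inner_conj innerBr -(fh _ _ Tgl) -(fk _ _ Tgl) subrr rmorph0 //.
Qed.

Lemma symmetric_sub_adj T : symmetric_op T -> T `<=` adj T.
Proof. by move=> symT [f h] Tfh g k Tgk /=; exact: symT. Qed.

Lemma adjS T A : A `<=` T -> adj T `<=` adj A.
Proof. by move=> AT gh Tgh f k /AT; exact: Tgh. Qed.

Lemma self_adjoint_symmetric T : self_adjoint T -> symmetric_op T.
Proof. by move=> [_ _ TE] f h g k Tfh; rewrite -{1}TE => /(_ _ _ Tfh). Qed.

(** By symmetry (h, f) is real, so the imaginary part of (h - z f, f) is - Im z |f|^2, and
    Cauchy-Schwarz bounds it. Here 2i Im z is written as z minus its conjugate. *)
Lemma shift_norm_ge T z f h : symmetric_op T -> T (f, h) ->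
  `|z - z^*| * `|f| <= 2 * `|h - z *: f|.
Proof.
move=> symT Tfh; have [->|f0] := eqVneq f 0.
  by rewrite normr0 mulr0 mulr_ge0.
have f_gt0 : 0 < `|f| by rewrite normr_gt0.
rewrite -(ler_pM2r f_gt0).
set w := inner (h - z *: f) f.
have ww : w - w^* = - (z - z^*) * `|f| ^+ 2.
  rewrite /w -inner_conj innerBl innerBr innerZl innerZr innerff.
  by rewrite (symT _ _ _ _ Tfh Tfh); ring.
have := CauchySchwarz_inner (h - z *: f) f; rewrite -/w => w_le.
apply: (@le_trans _ _ `|w - w^*|).
  by rewrite ww normrM normrN normrX normr_id mulrA.
apply: le_trans (ler_normB _ _) _; rewrite norm_conjC -mulrA mulr_natl mulr2n.
by rewrite lerD.
Qed.

Lemma shift_inj T z f h g k : is_operator T -> symmetric_op T -> z != z^* ->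
  T (f, h) -> T (g, k) -> h - z *: f = k - z *: g -> f = g.
Proof.
move=> [_ T_lin _] symT z_nreal Tfh Tgk hk.
have := T_lin (-1) _ _ Tgk Tfh; rewrite !scaleN1r => /(shift_norm_ge z symT) /=.
have -> : - k + h - z *: (- g + f) = 0.
  by rewrite scalerDr scalerN opprD opprK addrACA hk [- k + _]addrC -opprB
    addNr.
rewrite normr0 mulr0 pmulr_rle0 ?normr_gt0 ?subr_eq0 //.
by rewrite normr_le0 addrC subr_eq0 => /eqP.
Qed.

(** By [shift_norm_ge] the preimages form a Cauchy sequence, and the closed graph contains the
    limit. *)
Lemma shift_range_closed T z (u : nat -> H) (l : H) :
    is_operator T -> symmetric_op T -> seq_closed T -> z != z^* ->
    (forall n, exists f h, T (f, h) /\ h - z *: f = u n) -> u @ \oo --> l ->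
  exists f h, T (f, h) /\ h - z *: f = l.
Proof.
move=> [_ T_lin _] symT clT z_nreal /choice[a /choice[b ab]] ul.
have Tab n : T (a n, b n) by have [] := ab n.
have abE n : b n - z *: a n = u n by have [] := ab n.
have M_gt0 : 0 < `|z - z^*| by rewrite normr_gt0 subr_eq0.
have [|f af] := @cauchy_seq_cvg _ _ a.
  move=> e e_gt0; have [|N uN] := cvg_cauchy_seq ul (eps := `|z - z^*| * e / 2).
    by rewrite divr_gt0 ?mulr_gt0.
  exists N => m n Nm Nn; rewrite -(ltr_pM2l M_gt0).
  have := T_lin (-1) _ _ (Tab n) (Tab m).
  rewrite !scaleN1r => /(shift_norm_ge z symT).
  have -> : - b n + b m - z *: (- a n + a m) = u m - u n.
    by rewrite -!abE scalerDr scalerN opprD opprK addrACA addrC opprB [- b n +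
      _]addrC.
  rewrite [- a n + _]addrC => /le_lt_trans; apply.
  by rewrite mulrC -ltr_pdivlMr // uN.
exists f, (l + z *: f); split; last by rewrite addrK.
apply: (clT _ _ _ _ Tab af).
have -> : b = (fun n => u n + z *: a n) by apply/funext => n;
  rewrite -abE subrK.
apply: cvgD => //; apply: cvgZr => //.
Qed.

(** The range of T - z is closed, so x can be projected onto it; a residual orthogonal to that range
    is in the kernel of the shifted adjoint. *)
Lemma shift_range_decomp T z x :
    is_operator T -> symmetric_op T -> seq_closed T -> z != z^* ->
  exists f h, T (f, h) /\
    ker_shift (adj T) (z^*) (x - (h - z *: f)).
Proof.
move=> T_op symT clT z_nreal; have [T0 T_lin _] := T_op.
have [|||s [f [h [Tfh <-]]] orth] := @orthogonal_projection _ _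
    [set s | exists f h, T (f, h) /\ h - z *: f = s] x.
- by exists 0, 0; split => //; rewrite scaler0 subr0.
- move=> c _ _ [f [h [Tfh <-]]] [g [k [Tgk <-]]].
  exists (c *: f + g), (c *: h + k); split; first exact: (T_lin c _ _ Tfh Tgk).
  by rewrite scalerBr scalerDr opprD !scalerA [z * c]mulrC addrACA.
- by move=> u l; exact: shift_range_closed.
exists f, h; split => // g k Tgk /=.
have := orth (k - z *: g) (ex_intro _ g (ex_intro _ k (conj Tgk erefl))).
rewrite inner_conj => /(congr1 Num.conj);
  rewrite conjCK rmorph0 innerBl innerZl.
by move=> /eqP; rewrite subr_eq0 innerZr conjCK => /eqP.
Qed.

(** The residual of [shift_range_decomp] lies in the kernel of T shifted by the nonreal conjugate of
    z, hence is 0. *)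
Lemma self_adjoint_shift_surj T z x : self_adjoint T -> z != z^* ->
  exists f h, T (f, h) /\ h - z *: f = x.
Proof.
move=> T_sa z_nreal; have [T_op _ TE] := T_sa.
have symT := self_adjoint_symmetric T_sa.
have [|f [h [Tfh]]] := shift_range_decomp x T_op symT _ z_nreal.
  by rewrite -TE; exact: adj_seq_closed.
rewrite TE /ker_shift /= => Tw; exists f, h; split => //.
apply/eqP; rewrite eq_sym -subr_eq0; apply/eqP.
apply: (@shift_inj T (z^*) _ _ 0 0) Tw _ _ => //.
- by rewrite conjCK eq_sym.
- by case: T_op.
- by rewrite subrr scaler0 subr0.
Qed.

End Operators.

(** * The rigged triple and von Neumann's decomposition *)

Section RiggedTriple.
Context {R : realType} {H : hilbertType R} {A : operator H}.
Context (A_sym : symmetric_11 A).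
Implicit Types (f g h a : hplus A) (u v : hminus A) (z : R[i]).

Let A_dense : dense (dom A).
Proof. by case: A_sym. Qed.

Lemma adj_Astar f : adj A (f : H, Astar f).
Proof.
have /[!inE] -[h fh] := hplusP f.
exact: (@xgetPex _ 0 [set h | adj A (f : H, h)] (ex_intro _ h fh)).
Qed.

Lemma adj_hplus (f h : H) :
  adj A (f, h) -> exists2 F : hplus A, (F : H) = f & Astar F = h.
Proof.
move=> fh; have Ff : f \in hplus_pred A by rewrite inE; exists h.
exists (HPlus Ff) => //; apply: adj_uniq fh => //;
  exact: (adj_Astar (HPlus Ff)).
Qed.

Lemma AstarE f (h : H) : adj A (f : H, h) -> Astar f = h.
Proof. by move=> fh; apply: (adj_uniq A_dense) fh; exact: adj_Astar. Qed.

Lemma Astar_lin z f g : Astar (z *: f + g) = z *: Astar f + Astar g.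
Proof. by apply: AstarE; apply: (@adj_lin _ _ _ z); exact: adj_Astar. Qed.

Lemma Astar0 : Astar (0 : hplus A) = 0.
Proof. by have := Astar_lin (-1) 0 0; rewrite scaler0 addr0 scaleN1r addNr. Qed.

Lemma inner_plus_linl z f g h :
  inner_plus (z *: f + g) h = z * inner_plus f h + inner_plus g h.
Proof.
by rewrite /inner_plus Astar_lin !innerPl; ring.
Qed.

Lemma inner_plus_conj f g : inner_plus g f = (inner_plus f g)^*.
Proof.
by rewrite /inner_plus rmorphD /= (inner_conj (f : H)) (inner_conj (Astar f)).
Qed.

Lemma sub_adj_hplus (T : operator H) (f h : H) : T `<=` adj A -> T (f, h) ->
  exists2 F : hplus A, (F : H) = f & Astar F = h.
Proof. by move=> TA /TA /adj_hplus. Qed.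

Lemma hplusE z f g : hplus_val (z *: f + g) = z *: (f : H) + (g : H).
Proof. by []. Qed.

Lemma hminusD u v f : (u + v) f = u f + v f. Proof. by []. Qed.
Lemma hminusN u f : (- u) f = - u f. Proof. by []. Qed.
Lemma hminusZ z u f : (z *: u) f = z * u f. Proof. by []. Qed.
Lemma embE (h : H) f : emb A h f = inner h (f : H). Proof. by []. Qed.

Lemma hminus_antilin u z f g : u (z *: f + g) = z^* * u f + u g.
Proof. by have := hminusP u; rewrite inE => -[]. Qed.

Lemma hminus0 u : u 0 = 0.
Proof.
have := hminus_antilin u (-1) 0 0.
by rewrite scaler0 addr0 rmorphN1 mulN1r addNr.
Qed.

Lemma hminus_eq u v : u =1 v -> u = v.
Proof. by move=> uv; apply/val_inj/funext. Qed.

(** * The boundary form of A^* *)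

Definition in_dom f := A (f : H, Astar f).

Lemma in_dom_hplus (f h : H) :
  A (f, h) -> exists F : hplus A, [/\ in_dom F, (F : H) = f & Astar F = h].
Proof.
move=> Afh; case: (A_sym) => _ _ _ symA _.
have [F Ff Fh] := sub_adj_hplus (symmetric_sub_adj symA) Afh.
by exists F; split => //; rewrite /in_dom Ff Fh.
Qed.

(** It vanishes as soon as one argument lies in Dom A, so it sees only the boundary values of its
    arguments. *)
Definition lagrange f g := inner (Astar f) (g : H) - inner (f : H) (Astar g).

Lemma lagrange_linl z f g h :
  lagrange (z *: f + g) h = z * lagrange f h + lagrange g h.
Proof. by rewrite /lagrange Astar_lin !innerPl; ring. Qed.

Lemma lagrange_in_dom f h : in_dom f -> lagrange f h = 0.
Proof.
by move=> Af; apply/eqP; rewrite subr_eq0; apply/eqP/(adj_Astar h Af).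
Qed.

Lemma lagrange_conj f h : lagrange h f = - (lagrange f h)^*.
Proof.
rewrite /lagrange rmorphB /= -!(inner_conj _ (h : H)).
by rewrite -!(inner_conj _ (Astar h)) opprB.
Qed.

(** Tested on the dense Dom A, where u vanishes, the equation gives h = A^* f, and then u = 0. Thus
    an equation in H_- splits into its H part and its singular part. *)
Lemma emb_Astar_inj f (h : H) u : (forall a, in_dom a -> u a = 0) ->
  emb A (Astar f) + u = emb A h -> h = Astar f /\ u = 0.
Proof.
move=> uA fuh.
have hE : h = Astar f.
  apply/eqP; rewrite -subr_eq0; apply/eqP/(inner_dense_eq0 A_dense) => a [k].
  move=> /in_dom_hplus [a' [a'A <- _]].
  have := congr1 (fun w : hminus A => w a') fuh;
    rewrite hminusD uA // addr0 !embE.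
  by rewrite innerBl => ->; rewrite subrr.
split => //; apply/hminus_eq => g.
have := congr1 (fun w : hminus A => w g) fuh; rewrite hminusD hE.
by move=> /(canRL (addKr _)) ->; rewrite addNr.
Qed.

Lemma inner_ext (f g : H) : (forall h : H, inner f h = inner g h) -> f = g.
Proof.
move=> fg; apply/eqP; rewrite -subr_eq0; apply/eqP/inner_eq0.
by rewrite innerBl fg subrr.
Qed.

(** * Coordinates along the deficiency vectors *)

Context (gp gm : hplus A).
Context (gp_ker : ker_shift (adj A) 'i gp).
Context (gm_ker : ker_shift (adj A) (- 'i) gm).
Context (gp_norm : norm_plus gp = 1).
Context (gm_norm : norm_plus gm = 1).

Local Notation cp f := (inner_plus f gp).
Local Notation cm f := (inner_plus f gm).

Lemma Astar_gp : Astar gp = 'i *: (gp : H).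
Proof. exact: AstarE. Qed.

Lemma Astar_gm : Astar gm = - 'i *: (gm : H).
Proof. exact: AstarE. Qed.

Lemma cp_gp : cp gp = 1.
Proof. by rewrite -[LHS]sqrtCK -/(norm_plus gp) gp_norm expr1n. Qed.

Lemma cm_gm : cm gm = 1.
Proof. by rewrite -[LHS]sqrtCK -/(norm_plus gm) gm_norm expr1n. Qed.

(** Since A^* g_+ = i g_+, the term - (g_+, A^* h) equals i (A^* g_+, A^* h). *)
Lemma lagrange_gp h : lagrange gp h = 'i * (cp h)^*.
Proof.
rewrite -inner_plus_conj /lagrange /inner_plus Astar_gp !innerZl mulrDr mulrA.
by rewrite -expr2 sqrCi mulN1r.
Qed.

Lemma lagrange_gm h : lagrange gm h = - 'i * (cm h)^*.
Proof.
rewrite -inner_plus_conj /lagrange /inner_plus Astar_gm !innerZl mulrDr mulrA.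
by rewrite mulrNN -expr2 sqrCi mulN1r.
Qed.

Lemma cp_gm : cp gm = 0.
Proof.
rewrite /inner_plus Astar_gp Astar_gm innerZl innerZr conjCi mulrA mulrNN
  -expr2.
by rewrite sqrCi mulN1r subrr.
Qed.

Lemma cm_gp : cm gp = 0.
Proof. by rewrite inner_plus_conj cp_gm rmorph0. Qed.

(** The boundary form with g_+ vanishes on Dom A; by [lagrange_gp] this is (+)-orthogonality to
    g_+. *)
Lemma cp_in_dom a : in_dom a -> cp a = 0.
Proof.
move=> Aa; apply/eqP; rewrite -conjC_eq0 -(mulrI_eq0 _ (mulfI (neq0Ci R[i]))).
by rewrite -lagrange_gp lagrange_conj lagrange_in_dom // rmorph0 oppr0.
Qed.

Lemma cm_in_dom a : in_dom a -> cm a = 0.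
Proof.
move=> Aa; apply/eqP; rewrite -conjC_eq0 -(mulrI_eq0 _ (mulfI (neq0Ci R[i]))).
by rewrite -oppr_eq0 -mulNr -lagrange_gm lagrange_conj lagrange_in_dom //
  rmorph0 oppr0.
Qed.

Lemma gp_neq0 : (gp : H) != 0.
Proof.
apply/eqP => gp0; have /eqP := cp_gp; rewrite /inner_plus Astar_gp gp0 scaler0.
by rewrite linear0r addr0 eq_sym oner_eq0.
Qed.

Lemma gm_neq0 : (gm : H) != 0.
Proof.
apply/eqP => gm0; have /eqP := cm_gm; rewrite /inner_plus Astar_gm gm0 scaler0.
by rewrite linear0r addr0 eq_sym oner_eq0.
Qed.

Lemma one_dimensional_span (S : set H) (s t : H) :
  one_dimensional S -> S s -> s != 0 -> S t -> exists c : R[i], t = c *: s.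
Proof.
move=> [x x0 ->] [a _ <-] ax0 [b _ <-]; exists (b / a).
by rewrite scalerA divfK //; apply: contraNneq ax0 => ->; rewrite scale0r.
Qed.

Lemma ker_i_gp (f : H) : ker_shift (adj A) 'i f ->
  exists c : R[i], f = c *: (gp : H).
Proof.
case: (A_sym) => _ _ _ _ [def_i _]; apply: (one_dimensional_span def_i) => //.
exact: gp_neq0.
Qed.

Lemma ker_Ni_gm (f : H) : ker_shift (adj A) (- 'i) f ->
  exists c : R[i], f = c *: (gm : H).
Proof.
case: (A_sym) => _ _ _ _ [_ def_i]; apply: (one_dimensional_span def_i) => //.
exact: gm_neq0.
Qed.

Let Ni_nreal : - 'i != (- 'i : R[i])^*.
Proof.
by rewrite rmorphN /= conjCi opprK eq_sym -addr_eq0 -mulr2n mulrn_eq0 neq0Ci.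
Qed.

(** Decomposing (A^* + i) f along the range of A + i leaves a multiple c g_+. Subtracting from f the
    element a of Dom A so found and a preimage of c g_+ leaves an element of Ker (A^* + i). The
    coefficients are read off by (+)-orthonormality. *)
Lemma von_Neumann_decomp f : exists2 a, in_dom a &
  f = cp f *: gp + (cm f *: gm + a).
Proof.
case: (A_sym) => A_op A_closed _ symA _.
have [a' [k [/in_dom_hplus[a [Aa <- <-]]]]] := shift_range_decomp
  (Astar f - (- 'i) *: (f : H)) A_op symA (closed_seq_closed A_closed) Ni_nreal.
rewrite rmorphN /= conjCi opprK => /ker_i_gp[c cE].
(* A^* + i multiplies g_+ by 2i. *)
pose d := c / (2 * 'i).
pose F : hplus A := - d *: gp + (-1 *: a + f).
have [|b bE] := @ker_Ni_gm F.
  suff AF : Astar F = - 'i *: (F : H).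
    by rewrite /ker_shift /mkset -AF; exact: adj_Astar.
  apply: inner_ext => h; have := congr1 (fun w => inner w h) cE.
  rewrite /F !Astar_lin !hplusE Astar_gp !(innerBl, innerPl, innerZl).
  have -> : c = 2 * 'i * d by rewrite mulrC divfK // mulf_neq0 ?neq0Ci
    ?pnatr_eq0.
  move=> /eqP; rewrite -subr_eq0 => /eqP h0.
  by apply/eqP; rewrite -subr_eq0 -h0; apply/eqP; ring.
have fE : f = d *: gp + (b *: gm + a).
  apply: val_inj; apply: inner_ext => h.
  have := congr1 (fun w => inner w h) bE.
  by rewrite !hplusE !(innerPl, innerZl) => <-; ring.
have fp : cp f = d.
  by rewrite fE !inner_plus_linl cp_gp cp_gm cp_in_dom // mulr1 mulr0 !addr0.
have fm : cm f = b.
  by rewrite fE !inner_plus_linl cm_gp cm_gm cm_in_dom // mulr1 mulr0 add0r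
    addr0.
by exists a; rewrite // fp fm.
Qed.

Lemma lagrangeE f h :
  lagrange f h = 'i * (cp f * (cp h)^* - cm f * (cm h)^*).
Proof.
have [a Aa {1}->] := von_Neumann_decomp f.
by rewrite !lagrange_linl lagrange_gp lagrange_gm lagrange_in_dom //; ring.
Qed.

(** The value of [riesz_berezansky] is a representing vector or the default 0, and norm 1 excludes
    0. *)
Lemma riesz_pairing u g f :
  riesz_berezansky u = g -> norm_plus g = 1 -> pairing f u = inner_plus f g.
Proof.
rewrite /riesz_berezansky; case: xgetP => [h _ hP <- _|_ <-]; first exact: hP.
rewrite /norm_plus /inner_plus !linear0l add0r.
by rewrite Astar0 linear0l sqrtC0 => /esym/eqP; rewrite oner_eq0.
Qed.

(** * Restrictions of A^* and quasi-kernels *)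

(** Operators between A and A^* are encoded by a condition on the domain, below always a linear
    equation in the coordinates [cp] and [cm]. *)
Definition restriction (P : hplus A -> Prop) : operator H :=
  [set fh | exists F : hplus A, [/\ P F, (F : H) = fh.1 & Astar F = fh.2]].

Lemma restrictionP (P : hplus A -> Prop) f :
  P f -> restriction P (f : H, Astar f).
Proof. by move=> Pf; exists f. Qed.

Lemma restriction_sub (P : hplus A -> Prop) : restriction P `<=` adj A.
Proof. by move=> [f h] [F [_ /= <- <-]]; exact: adj_Astar. Qed.

Lemma sub_restriction (P : hplus A -> Prop) :
  (forall a, in_dom a -> P a) -> A `<=` restriction P.
Proof.
by move=> PA [f h] /in_dom_hplus [F [AF <- <-]]; exists F; split; auto.
Qed.

(** Since v vanishes on Dom A, [emb_Astar_inj] shows that B f lies in H only if the rank-one term is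
    0. *)
Lemma quasi_kernel_perturb (B : bop A) (l : hplus A -> R[i]) v :
    (forall f, B f = emb A (Astar f) + l f *: v) ->
    (forall a, in_dom a -> v a = 0) -> v != 0 ->
  quasi_kernel B = restriction (fun f => l f = 0).
Proof.
move=> BE vA v0; apply/seteqP.
split=> [[f h] [F /= <-]|[f h] [F [lF /= <- <-]]].
  rewrite BE => /emb_Astar_inj[a Aa|-> /eqP];
    first by rewrite hminusZ vA ?mulr0.
  by rewrite scaler_eq0 (negPf v0) orbF => /eqP lF; exists F.
by exists F => //; rewrite BE lF scale0r addr0.
Qed.

Lemma badjE (B : bop A) f g : badj B f g = (B g f)^*.
Proof. by []. Qed.

Lemma bReE (B : bop A) f g : bRe B f g = 2^-1 * (B f g + (B g f)^*).
Proof. by []. Qed.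

Lemma bImE (B : bop A) f g : bIm B f g = (2 * 'i)^-1 * (B f g - (B g f)^*).
Proof. by []. Qed.

Lemma bRe_conj (B : bop A) f g : (bRe B g f)^* = bRe B f g.
Proof.
by rewrite !bReE rmorphM rmorphD /= conjCK fmorphV /= conjC_nat addrC.
Qed.

Lemma badj_bRe (B : bop A) : badj (bRe B) = bRe B.
Proof.
by apply/val_inj/funext => f; apply: hminus_eq => g; rewrite -[RHS]bRe_conj.
Qed.

Lemma bRe_bIm (B : bop A) f : B f = bRe B f + 'i *: bIm B f.
Proof.
apply: hminus_eq => g; rewrite hminusD bReE hminusZ bImE.
by field; exact: neq0Ci.
Qed.

(** * The stated state-space operator, its real and imaginary parts *)

Context (phi psi : hminus A).
Context (phiE : forall f, pairing f phi = cp f).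
Context (psiE : forall f, pairing f psi = cm f).
Context (e : R[i]).
Context (e_unit : e * e^* = 1).

(** With e = e^{2 i alpha} this is sqrt 2 times the channel vector. The pairing of f with [chi] is
    [lm f], while [lp f = 0] describes A_alpha. *)
Let chi := phi - e *: psi.
Local Notation lp f := (cp f + e^* * cm f).
Local Notation lm f := (cp f - e^* * cm f).

Let e_neq0 : e != 0.
Proof.
by apply/eqP => e0; have /eqP := e_unit; rewrite e0 mul0r eq_sym oner_eq0.
Qed.

Lemma phi_val f : phi f = (cp f)^*.
Proof. by rewrite -phiE conjCK. Qed.

Lemma psi_val f : psi f = (cm f)^*.
Proof. by rewrite -psiE conjCK. Qed.

Lemma chi_val f : chi f = (lm f)^*.
Proof.
by rewrite hminusD hminusN hminusZ phi_val psi_val rmorphB rmorphM /= conjCK.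
Qed.

Lemma chi_in_dom a : in_dom a -> chi a = 0.
Proof.
by move=> Aa; rewrite chi_val cp_in_dom // cm_in_dom // mulr0 subrr rmorph0.
Qed.

Lemma chi_gp : chi gp = 1.
Proof. by rewrite chi_val cp_gp cm_gp mulr0 subr0 rmorph1. Qed.

Lemma chi_neq0 : chi != 0.
Proof.
apply/eqP => chi0; have := chi_gp; rewrite chi0 => /esym/eqP.
by rewrite (_ : (0 : hminus A) gp = 0) // oner_eq0.
Qed.

Lemma perturb_bop (u v : hminus A) :
  (fun f => emb A (Astar f) - ('i * pairing f u) *: v) \in @bop_pred R H A.
Proof.
have := hminusP u; rewrite inE => -[u_lin [M uM]].
have := hminusP v; rewrite inE => -[v_lin [N vN]].
rewrite inE; split=> [a f g|].
  apply: hminus_eq => h; rewrite !(hminusD, hminusN, hminusZ) !embE Astar_lin.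
  by rewrite innerPl /pairing u_lin rmorphD rmorphM /= conjCK; ring.
exists (1 + M * N) => f g; rewrite hminusD hminusN hminusZ embE.
apply: le_trans (ler_normB _ _) _; rewrite mulrDl mul1r mulrDl lerD //.
  apply: le_trans (CauchySchwarz_inner _ _) _.
  rewrite ler_pM ?norm_le_plus //.
  rewrite -(@ler_pXn2r _ 2) ?nnegrE ?norm_plus_ge0 // sqrtCK /inner_plus.
  by rewrite !innerff lerDr exprn_ge0.
rewrite !normrM normCi mul1r /pairing norm_conjC.
by rewrite [M * N * _]mulrAC -[M * _ * N * _]mulrA ler_pM.
Qed.

Definition state0 : bop A := BOp (perturb_bop psi (e^* *: phi - psi)).

Section StateForm.
Context (S : bop A).
Context (SE : forall f,
  S f = emb A (Astar f) - ('i * pairing f psi) *: (e^* *: phi - psi)).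

(** As e is unimodular, [e^* *: phi - psi] is [e^* *: chi], so every perturbation of A^* below is
    along [chi]. *)
Lemma state_chi f : S f = emb A (Astar f) + - ('i * e^* * cm f) *: chi.
Proof.
apply: hminus_eq => g; rewrite SE psiE.
rewrite !(hminusD, hminusN, hminusZ) phi_val psi_val.
ring: e_unit.
Qed.

(** Moving A^* across the inner product costs the boundary form; its [cm] term cancels against the
    perturbation because e is unimodular. *)
Lemma state_adj_chi f : badj S f = emb A (Astar f) + - ('i * cp f) *: chi.
Proof.
apply: hminus_eq => g; rewrite badjE state_chi !hminusD !hminusZ !chi_val !embE.
rewrite rmorphD !rmorphM rmorphN !rmorphM !rmorphB !rmorphM /= !conjCK conjCi.
rewrite -inner_conj.
have /eqP := lagrangeE f g; rewrite /lagrange subr_eq => /eqP ->.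
ring: e_unit.
Qed.

Lemma state_Re_chi f :
  bRe S f = emb A (Astar f) + - ('i / 2 * lp f) *: chi.
Proof.
apply: hminus_eq => g; rewrite bReE.
rewrite -[(S g f)^*]/(badj S f g) state_adj_chi state_chi !(hminusD, hminusZ).
by field.
Qed.

Lemma state_Im_chi f : bIm S f = (2^-1 * lm f) *: chi.
Proof.
apply: hminus_eq => g; rewrite bImE.
rewrite -[(S g f)^*]/(badj S f g) state_adj_chi state_chi !(hminusD, hminusZ).
by field; exact: neq0Ci.
Qed.

Lemma state_quasi_kernel : quasi_kernel S = restriction (fun f => cm f = 0).
Proof.
rewrite (quasi_kernel_perturb state_chi chi_in_dom chi_neq0); congr restriction.
apply/funext => f; apply/propext; split=> [/eqP|->];
  last by rewrite mulr0 oppr0.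
rewrite oppr_eq0 !mulf_eq0 (negPf (neq0Ci _)) conjC_eq0 (negPf e_neq0) /=.
by move/eqP.
Qed.

Lemma state_Re_quasi_kernel :
  quasi_kernel (bRe S) = restriction (fun f => lp f = 0).
Proof.
rewrite (quasi_kernel_perturb state_Re_chi chi_in_dom chi_neq0).
congr restriction.
apply/funext => f; apply/propext; split=> [/eqP|->];
  last by rewrite mulr0 oppr0.
rewrite oppr_eq0 !mulf_eq0 invr_eq0 (negPf (neq0Ci _)) pnatr_eq0 /=.
by move/eqP.
Qed.

End StateForm.

(** Put w = g_+ - e g_-. On Dom T the boundary form with w vanishes, and it equals i times [lp].
    Conversely, [lp F = 0] reduces von Neumann's decomposition to F = [cp F] w + a with a in Dom
    A. *)
Lemma self_adjoint_ext_restriction (T : operator H) :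
    self_adjoint_ext A T -> dom T ((gp : H) - e *: (gm : H)) ->
  T = restriction (fun f => lp f = 0).
Proof.
move=> [AT T_sa] [k Tk]; have [[_ T_lin _] _ TE] := T_sa.
have T_adj : T `<=` adj A by rewrite -TE; exact: adjS.
pose w : hplus A := - e *: gm + gp.
have wE : (w : H) = (gp : H) - e *: (gm : H) by rewrite hplusE scaleNr addrC.
have Tw : T (w : H, Astar w).
  by rewrite (@AstarE w k) wE //; exact: T_adj.
apply/seteqP; split=> [[f h] Tfh|[f h] [F [lF /= <- <-]]].
  have [F Ff Fh] := sub_adj_hplus T_adj Tfh; exists F; split => //=.
  have : lagrange F w = 0.
    apply/eqP; rewrite subr_eq0; apply/eqP; rewrite Ff Fh.
    exact: (self_adjoint_symmetric T_sa Tfh Tw).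
  rewrite lagrangeE !inner_plus_linl cp_gm cp_gp cm_gm cm_gp mulr0 mulr1 add0r
    addr0.
  rewrite rmorph1 mulr1 rmorphN /= mulrN opprK [cm F * _]mulrC => /eqP.
  by rewrite mulf_eq0 (negPf (neq0Ci _)) => /eqP.
have [a Aa FE] := von_Neumann_decomp F.
have -> : F = cp F *: w + a.
  rewrite {1}FE /w scalerDr addrA; congr (_ + _); rewrite addrC; congr (_ + _).
  rewrite scalerA; congr (_ *: _); move/eqP: lF; rewrite addr_eq0 => /eqP ->.
  by rewrite mulrNN mulrAC [e^* * e]mulrC e_unit mul1r.
rewrite Astar_lin hplusE; exact: (T_lin _ _ _ Tw (AT _ Aa)).
Qed.

(** * The main operator *)

Section MainOperator.
Context (T : operator H).
Context (T_main : quasi_self_adjoint_ext A T).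
Context (T_sub : T `<=` restriction (fun f => cm f = 0)).

(** The condition [cm f = 0] leaves Dom A + span g_+. Being non-symmetric, T is not contained in A,
    so it has a vector with [cp] nonzero, and then g_+ itself. *)
Lemma main_operator_restriction : T = restriction (fun f => cm f = 0).
Proof.
have [[T_0 T_lin _] AT T_adj T_nsym] := T_main.
apply/seteqP; split=> [//|[f h] [F [F0 /= <- <-]]].
have [G [G0 Gp TG]] : exists G : hplus A, [/\ cm G = 0, cp G != 0 & T (G : H,
  Astar G)].
  apply: contrapT => noG; apply: T_nsym.
  have TA : T `<=` A.
    move=> [g k] Tgk; have [G [G0 /= Gg Gk]] := T_sub Tgk.
    have Gp0 : cp G = 0.
      by apply: contrapT => /eqP Gp; apply: noG; exists G; rewrite Gg Gk.
    have [a Aa GE] := von_Neumann_decomp G.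
    by rewrite -Gg -Gk GE Gp0 G0 !scale0r !add0r.
  by case: A_sym => _ _ _ symA _ f1 h1 g1 k1 /TA A1 /TA A2; exact: symA A1 A2.
have [a Aa GE] := von_Neumann_decomp G.
have [b Ab FE] := von_Neumann_decomp F.
move: GE FE; rewrite G0 F0 !scale0r !add0r => GE FE.
have Tgp : T (gp : H, Astar gp).
  have -> : gp = (cp G)^-1 *: (-1 *: a + G) + 0.
    by rewrite {2}GE addrCA scaleN1r addNr !addr0 scalerA mulVf // scale1r.
  rewrite !Astar_lin Astar0; exact: (T_lin (cp G)^-1 _ _ (T_lin (-1) _ _ (AT _
    Aa) TG) T_0).
rewrite FE Astar_lin hplusE; exact: (T_lin _ _ _ Tgp (AT _ Ab)).
Qed.

Lemma main_operator_kappa : vonNeumann_kappa (gp : H) (gm : H) T 0.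
Proof.
rewrite /vonNeumann_kappa normr0 ltr01 scale0r subr0 main_operator_restriction.
by split => //; exists (Astar gp); exists gp; rewrite cm_gp.
Qed.

End MainOperator.

Lemma restriction_lin (l : hplus A -> R[i]) :
    (forall z f g, l (z *: f + g) = z * l f + l g) ->
  is_operator (restriction (fun f => l f = 0)).
Proof.
move=> l_lin; have l0 : l 0 = 0.
  by have := l_lin (-1) 0 0; rewrite scaler0 addr0 mulN1r addNr.
split=> [|z [f h] [g k]|f h k].
- by exists 0; split => //; exact: Astar0.
- move=> [F [lF /= <- <-]] [G [lG /= <- <-]].
  by exists (z *: F + G); rewrite l_lin lF lG mulr0 addr0 Astar_lin.
- by move=> /restriction_sub fh /restriction_sub; exact: adj_uniq fh.
Qed.

Let T0 := restriction (fun f => cm f = 0).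

Lemma main_operator0 : quasi_self_adjoint_ext A T0.
Proof.
split; first by apply: restriction_lin => z f g; exact: inner_plus_linl.
- by apply: sub_restriction => a; exact: cm_in_dom.
- exact: restriction_sub.
- have Tgp : T0 (gp : H, Astar gp) by apply: restrictionP; exact: cm_gp.
  move=> /(_ _ _ _ _ Tgp Tgp)/eqP; rewrite -subr_eq0 -/(lagrange gp gp)
    lagrange_gp.
  by rewrite cp_gp rmorph1 mulr1 (negPf (neq0Ci _)).
Qed.

Lemma T0_lagrange f : cm f = 0 -> lagrange f f = 'i * `|cp f| ^+ 2.
Proof. by move=> f0; rewrite lagrangeE f0 mul0r subr0 normCK. Qed.

(** The boundary form of f with itself is 2i Im (A^* f, f), and equals i |[cp f]|^2 when
    [cm f = 0]. *)
Lemma main_operator0_dissipative : dissipative T0.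
Proof.
move=> f h [F [F0 /= <- <-]]; rewrite ImE -inner_conj -opprB -/(lagrange F F).
rewrite T0_lagrange // mulrN mulrA -expr2 sqrCi mulN1r opprK.
by rewrite divr_ge0 ?exprn_ge0.
Qed.

(** Dissipativity gives Im ((T0 + i) f, f) >= |f|^2, whence the bound with constant 1. *)
Lemma main_operator0_resolvent : resolvent_set T0 (- 'i).
Proof.
split=> [x|].
  case: (A_sym) => A_op A_closed _ symA _.
  have [a' [k [/in_dom_hplus[a [Aa <- <-]]]]] := shift_range_decomp
    x A_op symA (closed_seq_closed A_closed) Ni_nreal.
  rewrite rmorphN /= conjCi opprK => /ker_i_gp[c cE].
  (* Here x = (A + i) a + c g_+, and A^* + i multiplies g_+ by 2i. *)
  pose F : hplus A := (c / (2 * 'i)) *: gp + a.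
  exists F, (Astar F); split.
    by apply: restrictionP; rewrite inner_plus_linl cm_gp cm_in_dom // mulr0
      addr0.
  apply: inner_ext => h; have := congr1 (fun w => inner w h) cE.
  rewrite /F !Astar_lin !hplusE Astar_gp !(innerBl, innerPl, innerZl).
  move=> /eqP; rewrite subr_eq => /eqP ->.
  by field; exact: neq0Ci.
exists 1 => f h [F [F0 /= <- <-]]; rewrite mul1r.
have [->|f0] := eqVneq (F : H) 0; first by rewrite normr0.
have f_gt0 : 0 < `|F : H| by rewrite normr_gt0.
rewrite -(ler_pM2r f_gt0) -expr2.
set w := inner (Astar F - - 'i *: (F : H)) (F : H).
have ww : w - w^* = 'i * (`|cp F| ^+ 2 + 2 * `|F : H| ^+ 2).
  rewrite mulrDr -T0_lagrange // /w -inner_conj innerBl innerBr innerZl innerZr.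
  by rewrite rmorphN /= conjCi innerff /lagrange; ring.
have := CauchySchwarz_inner (Astar F - - 'i *: (F : H)) (F : H); rewrite -/w.
apply: le_trans; rewrite -(ler_pM2l (ltr0Sn _ 1)).
apply: le_trans (_ : `|w - w^*| <= _); last first.
  by apply: le_trans (ler_normB _ _) _; rewrite norm_conjC mulr_natl mulr2n.
rewrite ww normrM normCi mul1r ger0_norm ?addr_ge0 ?mulr_ge0 ?exprn_ge0 //.
by rewrite lerDr exprn_ge0.
Qed.

(** Since g_+ is in Dom T0, the boundary form with g_+ vanishes on the domain of the adjoint. *)
Lemma adj_main_operator0 (f h : H) : adj T0 (f, h) ->
  exists F : hplus A, [/\ (F : H) = f, Astar F = h & cp F = 0].
Proof.
move=> T0fh; have [|F Ff Fh] := @adj_hplus f h.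
  by apply: adjS T0fh; apply: sub_restriction => a; exact: cm_in_dom.
exists F; split => //.
have Tgp : T0 (gp : H, Astar gp) by apply: restrictionP; exact: cm_gp.
have : lagrange gp F = 0.
  by apply/eqP; rewrite subr_eq0 Ff Fh; apply/eqP; exact: T0fh _ _ Tgp.
rewrite lagrange_gp => /eqP; rewrite mulf_eq0 (negPf (neq0Ci _)) conjC_eq0.
by move/eqP.
Qed.

Lemma state_star_extension (S : bop A) :
    (forall f, S f = emb A (Astar f) - ('i * pairing f psi) *: (e^* *: phi -
        psi)) ->
    self_adjoint (restriction (fun f => lp f = 0)) ->
  star_extension T0 S.
Proof.
move=> SE Re_sa; have [_ AT0 T0_adj _] := main_operator0; split => //.
- by rewrite (state_quasi_kernel SE).
- move=> [f h] /adj_main_operator0 [F [Ff Fh F0]]; exists F => //.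
  by rewrite (state_adj_chi SE) F0 mulr0 oppr0 scale0r addr0 Fh.
- move=> [f h] Afh g k /T0_adj /= gk; rewrite inner_conj -(gk _ _ Afh).
  by rewrite -inner_conj.
- split; last by rewrite (state_Re_quasi_kernel SE).
  split; last exact: badj_bRe.
  rewrite (state_Re_quasi_kernel SE); apply: sub_restriction => a Aa.
  by rewrite cp_in_dom // cm_in_dom // mulr0 addr0.
Qed.

(** * Construction of the L-system *)

(** The remaining fields are proofs, equal by proof irrelevance. *)
Lemma L_system_eq (Th Th' : L_system A) : main_op Th = main_op Th' ->
  state_op Th = state_op Th' -> channel_op Th = channel_op Th' -> Th = Th'.
Proof.
case: Th => T1 S1 K1 ? ? ? ? ? ? ?; case: Th' => T2 S2 K2 ? ? ? ? ? ? ? /=.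
by move=> ? ? ?; subst; congr LSystem; exact: Prop_irrelevance.
Qed.

Let s : R[i] := (sqrtC 2)^-1.

Let s_conj : s^* = s.
Proof. by rewrite geC0_conj // invr_ge0 sqrtC_ge0. Qed.

Let s_sqr : s ^+ 2 = 2^-1.
Proof. by rewrite exprVn sqrtCK. Qed.

Section Existence.
Context (Re_sa : self_adjoint (restriction (fun f => lp f = 0))).

Let K0 (c : R[i]) := c *: (s *: chi).

Let state0E f :
  state0 f = emb A (Astar f) - ('i * pairing f psi) *: (e^* *: phi - psi).
Proof. by []. Qed.

Lemma channel0 : is_channel K0.
Proof.
split=> [a c d|]; first by rewrite /K0 scalerDl -[(a * c) *: _]scalerA.
have := hminusP (s *: chi); rewrite inE => -[_ [M chiM]].
by exists M => c f; rewrite hminusZ normrM mulrAC mulrC ler_wpM2r //.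
Qed.

Lemma channel_adj_chi (K : R[i] -> hminus A) f :
  K 1 = s *: chi -> channel_adj K f = s * lm f.
Proof.
move=> K1; rewrite /channel_adj K1 /pairing hminusZ chi_val rmorphM /= conjCK.
by rewrite s_conj.
Qed.

Lemma state0_Im f : bIm state0 f = K0 (channel_adj K0 f).
Proof.
rewrite (state_Im_chi state0E) (@channel_adj_chi K0) /K0 ?scale1r //.
by rewrite scalerA mulrAC -expr2 s_sqr.
Qed.

Definition system0 : L_system A :=
  LSystem A_sym main_operator0 main_operator0_dissipative
    (ex_intro _ _ main_operator0_resolvent) (state_star_extension state0E Re_sa)
    channel0 state0_Im.

End Existence.

Lemma Im_gt0_nreal z : 0 < 'Im z -> z != z^*.
Proof.
by rewrite ImE; apply: contraTneq => <-; rewrite subrr mulr0 mul0r ltxx.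
Qed.

(** Both summands of (g_+, g_+)_+ = 1 are equal because A^* g_+ = i g_+. *)
Lemma inner_gp : inner (gp : H) (gp : H) = 2^-1.
Proof.
have := cp_gp; rewrite /inner_plus Astar_gp innerZl innerZr conjCi mulrA mulrN.
rewrite -expr2 sqrCi opprK mul1r => gp1.
by apply: (@mulfI _ 2); rewrite ?pnatr_eq0 // mulfV ?pnatr_eq0 // mulr_natl
  mulr2n.
Qed.

(** * The impedance function and the Weyl-Titchmarsh function *)

Section WeylTitchmarsh.
Context (T : operator H) (g : H).
Context (T_ext : self_adjoint_ext A T).
Context (T_dom : dom T ((gp : H) - e *: (gm : H))).
Context (g_ker : ker_shift (adj A) 'i g).
Context (g_norm : `|g| = 1).

Let TE : T = restriction (fun f => lp f = 0).
Proof. exact: self_adjoint_ext_restriction. Qed.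

(** Take r = (T - z)^{-1} g. From T r = z r + g follows z T r + r = z g + (z^2 + 1) r, to be paired
    with the unit vector g. *)
Lemma weyl_titchmarshE z : z != z^* -> exists r : hplus A,
  [/\ lp r = 0, Astar r = z *: (r : H) + g &
      weyl_titchmarsh T g z = z + (z ^+ 2 + 1) * inner (r : H) g].
Proof.
move=> z_nreal; have [_ T_sa] := T_ext; have [T_op _ _] := T_sa.
have symT := self_adjoint_symmetric T_sa.
have [f [k [Tfk fk]]] := self_adjoint_shift_surj g T_sa z_nreal.
have := Tfk; rewrite {1}TE => -[r [lr /= rf rk]]; exists r; split => //.
  by rewrite rf rk -fk addrC subrK.
rewrite /weyl_titchmarsh.
have -> : resolvent T z g = f.
  apply: xget_unique => [|f' [k' Tfk' fk']]; first by exists k.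
  by apply: (shift_inj T_op symT z_nreal Tfk' Tfk); rewrite fk fk'.
have -> : app T f = k.
  by apply: xget_unique => [//|k' Tfk']; case: T_op => _ _ T_uniq;
    exact: T_uniq Tfk.
have -> : k = g + z *: f by rewrite -fk subrK.
by rewrite rf !(innerPl, innerDl, innerZl) innerff g_norm; ring.
Qed.

Lemma impedance_chi (Th : L_system A) z :
    (forall f, bRe (state_op Th) f =
       emb A (Astar f) + - ('i / 2 * lp f) *: chi) ->
    channel_op Th 1 = s *: chi -> z != z^* ->
  impedance Th z = weyl_titchmarsh T g z.
Proof.
move=> ReE K1 z_nreal; have [r [lr rE ->]] := weyl_titchmarshE z_nreal.
have [_ T_sa] := T_ext; have [T_op _ _] := T_sa.
have symT := self_adjoint_symmetric T_sa.
have [c gE] := ker_i_gp g_ker.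
have cc : c * c^* = 2.
  have := innerff g; rewrite g_norm expr1n gE innerZl innerZr inner_gp mulrA.
  by move/(canRL (mulfVK _)); rewrite mul1r; apply; rewrite pnatr_eq0.
(* The equation for F requires [lp F = 2 * 'i * s], while [lp] takes the value c on (z - i) r + c
   g_+. The factor is thus 2is / c, and |c|^2 = 2. *)
pose d := 'i * c^* * s.
(* The summands 0 let the lemmas about [_ *: _ + _] apply. *)
pose F : hplus A := d *: ((z - 'i) *: r + (c *: gp + 0)) + 0.
have FA : Astar F = z *: (F : H).
  rewrite /F !Astar_lin Astar0 rE gE !hplusE Astar_gp.
  by apply: inner_ext => h; rewrite !(innerPl, innerZl, innerDl, linear0l);
    ring.
have l_lin (b : R[i]) f f' : lp (b *: f + f') = b * lp f + lp f'.
  by rewrite !inner_plus_linl; ring.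
have lF : lp F = 2 * 'i * s.
  rewrite /F !l_lin lr cp_gp cm_gp /inner_plus Astar0 !linear0l /d.
  ring: cc.
have lmF f : lm f = 2 * cp f - lp f by ring.
rewrite /impedance (xget_unique _ (x := F)).
- rewrite (channel_adj_chi _ K1) lmF lF.
  (* The second summand of [inner_plus F gp] is (z F, i g_+) = - i z (F, g_+). *)
  have -> : cp F = (1 - 'i * z) * inner (F : H) (gp : H).
    by rewrite /inner_plus FA Astar_gp innerZl innerZr conjCi; ring.
  rewrite /F !hplusE !innerPl inner_gp linear0l gE innerZr /d.
  have ii := sqrCi R[i].
  transitivity (s ^+ 2 * (2 * ((1 - 'i * z) * ('i *
      ((z - 'i) * (c^* * inner (r : H) (gp : H)) + c * c^* / 2))) - 2 * 'i)).
    ring.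
  by rewrite cc s_sqr; field: ii.
- change (bRe (state_op Th) F - z *: emb A (F : H) = channel_op Th 1).
  apply: hminus_eq => h; rewrite ReE lF FA K1.
  rewrite !(hminusD, hminusN, hminusZ) !embE innerZl.
  have ii := sqrCi R[i].
  by field: ii.
(* Uniqueness: another solution f also satisfies A^* f = z f and has the same [lp], so f - F lies in
   Dom T and in the kernel of T - z, which is trivial. *)
move=> f.
have -> : [set f | bRe (state_op Th) f - z *: emb A f = channel_op Th 1] f =
  (bRe (state_op Th) f - z *: emb A (f : H) = channel_op Th 1) by [].
rewrite ReE K1 => fE.
have [] := @emb_Astar_inj f (z *: (f : H)) (- ('i / 2 * lp f + s) *: chi).
- by move=> a Aa; rewrite hminusZ chi_in_dom ?mulr0.
- move: fE => /(canRL (subrK _)) fE; apply: hminus_eq => h.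
  have := congr1 (fun u : hminus A => u h) fE.
  rewrite !(chi_val, hminusD, hminusN, hminusZ) !embE innerZl => fEh.
  by rewrite -[RHS](addKr (s * (lm h)^*)) -fEh; ring.
move=> fA /eqP; rewrite scaler_eq0 (negPf chi_neq0) orbF oppr_eq0 => /eqP lf.
pose D := -1 *: F + f.
have DA : Astar D = z *: (D : H).
  rewrite Astar_lin FA -fA.
  by apply: inner_ext => h; rewrite hplusE !(innerPl, innerZl); ring.
have lD : lp D = 0.
  rewrite l_lin lF; apply: (@mulfI _ ('i / 2)).
    by rewrite mulf_neq0 ?neq0Ci ?invr_eq0 ?pnatr_eq0.
  have ii := sqrCi R[i].
  by rewrite mulr0 -lf; field: ii.
have D0 : (D : H) = 0.
  have [T_0 _ _] := T_op.
  apply: (shift_inj T_op symT z_nreal (_ : T (_, Astar D)) T_0).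
    by rewrite TE; exact: restrictionP.
  by rewrite DA subrr scaler0 subr0.
apply: val_inj => /=; apply: inner_ext => h.
have := congr1 (fun w : H => inner w h) D0.
rewrite hplusE innerPl linear0l mulN1r => /(canRL (addKr _)).
by rewrite opprK addr0.
Qed.

End WeylTitchmarsh.

(** * Systems whose impedance agrees with the Weyl-Titchmarsh function at i *)

Section Determined.
Context (Th : L_system A).
Context (qkRe : quasi_kernel (bRe (state_op Th)) =
  restriction (fun f => lp f = 0)).
Context (imp_i : impedance Th 'i = 'i).

Let S := state_op Th.
Let B := bRe S.
Let X := channel_op Th 1.
(** As [lp gp] is 1, this is the only candidate for v in Re AA = A^* + [lp] v. *)
Let v := B gp - emb A (Astar gp).

Let channel_pairing f : bIm S f = pairing f X *: X.
Proof.
rewrite L_Im; have [K_lin _] := L_channel Th.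
have K0 : channel_op Th 0 = 0.
  by have := K_lin (-1) 0 0; rewrite mulr0 addr0 scaleN1r addNr.
by rewrite -[X in channel_op Th X]addr0 -[X in channel_op Th (X + _)]mulr1
  K_lin K0 addr0.
Qed.

Let B_ker f : lp f = 0 -> B f = emb A (Astar f).
Proof.
move=> lf; have := @restrictionP (fun f => lp f = 0) f lf.
rewrite -qkRe => -[f' ff' f'E].
by have -> : B f = B f' by congr (B _); apply: val_inj.
Qed.

Lemma determined_Re f : B f = emb A (Astar f) + lp f *: v.
Proof.
pose f' := - lp f *: gp + f.
have f'0 : lp f' = 0 by rewrite !inner_plus_linl cp_gp cm_gp; ring.
have -> : B f = lp f *: B gp + B f'.
  by rewrite -bop_linear; congr (B _); rewrite addrA scaleNr addrN add0r.
rewrite (B_ker f'0) Astar_lin; apply: hminus_eq => h.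
by rewrite /v !(hminusD, hminusN, hminusZ) !embE innerPl; ring.
Qed.

(** Hermiticity of Re AA on the pair g_+, h expresses v through the single number [v gp]; for h =
    g_+ it fixes the imaginary part of that number. *)
Lemma determined_v h : v h = - 'i * (cp h)^* + (lp h)^* * (v gp)^*.
Proof.
have BE := determined_Re; clearbody v.
have := bRe_conj S gp h; rewrite -/B !BE cp_gp cm_gp mulr0 addr0 scale1r.
rewrite !hminusD !hminusZ !embE rmorphD rmorphM /= -inner_conj => vE.
rewrite mulNr -lagrange_gp /lagrange opprB.
by rewrite addrAC vE addrAC subrr add0r.
Qed.

Lemma determined_v_in_dom a : in_dom a -> v a = 0.
Proof.
by move=> Aa; rewrite determined_v cp_in_dom // cm_in_dom // mulr0 addr0
  !rmorph0 mulr0 mul0r addr0.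
Qed.

(** On Dom A the operator AA is A, so the value of Im AA at the pair a, a vanishes; but that value
    is |X a|^2. *)
Lemma determined_channel_in_dom a : in_dom a -> X a = 0.
Proof.
move=> Aa; have [TS AT _ _ _] := L_state Th.
have Sa : S a = emb A (Astar a).
  have [f fa fS] := TS _ (AT _ Aa).
  by have -> : S a = S f by congr (S _); apply: val_inj.
have := congr1 (fun u : hminus A => u a) (channel_pairing a).
rewrite bImE Sa embE hminusZ.
have := lagrange_in_dom a Aa; rewrite /lagrange -inner_conj => ->.
rewrite mulr0 /pairing mulrC -normCK => /esym/eqP.
by rewrite sqrf_eq0 normr_eq0 => /eqP.
Qed.

(* If the equation defining the impedance at i had no solution, [impedance]
   would take the junk value 0, which is not i. *)
Lemma determined_solution :
  exists2 w : R[i], X = w *: v & w * w^* * (v gp)^* = 'i.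
Proof.
have BE := determined_Re; have vA := determined_v_in_dom.
have XA := determined_channel_in_dom.
move: imp_i; rewrite /impedance -/S -/B /channel_adj -/X.
case: xgetP => [f _ fX|_]; last first.
  by rewrite /pairing hminus0 rmorph0 => /esym/eqP; rewrite (negPf (neq0Ci _)).
have {fX} : B f - 'i *: emb A (f : H) = X := fX.
rewrite BE => fX; clearbody v.
have [] := @emb_Astar_inj f ('i *: (f : H)) (lp f *: v - X).
- by move=> a Aa; rewrite hminusD hminusN hminusZ vA // XA // mulr0 subr0.
- by apply: hminus_eq => h; rewrite -fX !(hminusD, hminusN, hminusZ) !embE
  innerZl; ring.
move=> fA /eqP; rewrite subr_eq0 => /eqP lX.
(* The solution lies in Ker (A^* - i), so f = w g_+ and [lp f = w]; the singular part of the
   equation reads X = w v. *)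
have [|w fw] := @ker_i_gp f; first by rewrite /ker_shift /mkset fA;
  exact: adj_Astar.
have {}fw : f = w *: gp + 0 by apply: val_inj; rewrite addr0.
rewrite /pairing -lX fw !inner_plus_linl cp_gp cm_gp.
have -> : w * 1 + cp 0 + e^* * (w * 0 + cm 0) = w.
  by rewrite /inner_plus Astar0 !linear0l; ring.
rewrite hminusZ hminus_antilin hminus0 addr0 !rmorphM /= conjCK => wv.
by exists w => //; rewrite -wv; ring.
Qed.

(** The conditions on w and v give |w|^2 = 2 and Im AA = (1/2) [lm] X' with X' = 2i v up to sign
    conventions absorbed below: AA = A^* + ([lp] - [lm]) v = A^* + 2 [e^* * cm] v. Its quasi-kernel,
    which contains T, is therefore [cm = 0]. *)
Lemma state_determined : main_op Th `<=` restriction (fun f => cm f = 0).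
Proof.
have BE := determined_Re; have vA := determined_v_in_dom;
  have vE := determined_v.
have [w Xw wv] := determined_solution.
clearbody v.
have SE f : S f = emb A (Astar f) + lp f *: v + 'i *: (pairing f X *: X).
  by rewrite (bRe_bIm S) -/B BE channel_pairing.
have ww_real : (w * w^*)^* = w * w^* by rewrite rmorphM /= conjCK mulrC.
have vgp : v gp = - 'i + (v gp)^*.
  by rewrite {1}vE cp_gp cm_gp mulr0 addr0 rmorph1 mulr1 mul1r.
have wv' : w * w^* * v gp = - 'i.
  by rewrite -conjCi -wv rmorphM /= ww_real conjCK.
(* Multiplying [vgp] by |w|^2 and inserting [wv] and [wv'] gives - i = - i |w|^2 + i. *)
have ww : w * w^* = 2.
  apply: (mulfI (neq0Ci R[i])); apply/eqP; rewrite -subr_eq0; apply/eqP.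
  move: wv'; rewrite vgp mulrDr wv => /eqP; rewrite -subr_eq0 => /eqP wv'.
  by rewrite -[RHS]oppr0 -[in RHS]wv'; ring.
have vgp2 : (v gp)^* = 'i / 2 by rewrite -wv ww mulrC mulKf ?pnatr_eq0.
have {}SE f : S f = emb A (Astar f) + (2 * e^* * cm f) *: v.
  rewrite SE Xw /pairing.
  have -> : ((w *: v) f)^* = w^* * ('i / 2 * lm f).
    rewrite hminusZ rmorphM /= vE vgp2 rmorphD !rmorphM rmorphN /= conjCi
      !conjCK opprK.
    by rewrite fmorphV /= conjC_nat; field.
  have ii := sqrCi R[i].
  apply: hminus_eq => h; rewrite !(hminusD, hminusZ).
  transitivity (emb A (Astar f) h + lp f * v h +
    w * w^* * ('i ^+ 2 / 2 * lm f * v h)); first by field.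
  by rewrite ww ii; field.
have v0 : v != 0.
  apply/eqP => v0; move: vgp2; rewrite v0 (_ : (0 : hminus A) gp = 0) //
    rmorph0.
  by move=> /esym/eqP; rewrite mulf_eq0 (negPf (neq0Ci _)) invr_eq0 pnatr_eq0.
have [TS _ _ _ _] := L_state Th.
apply: subset_trans TS _; rewrite (quasi_kernel_perturb SE vA v0).
move=> fh [f [/eqP f0 ff fA]]; exists f; split => //; move: f0.
by rewrite !mulf_eq0 pnatr_eq0 conjC_eq0 (negPf e_neq0) => /eqP.
Qed.

End Determined.
End RiggedTriple.

(** * Existence, uniqueness and the von Neumann parameters *)

Lemma expiN (R : realType) (t : R) : expi (- t) = (expi t)^*.
Proof. by rewrite /expi cosN sinN. Qed.

Lemma expi_unit (R : realType) (t : R) : expi t * (expi t)^* = 1.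
Proof.
rewrite -expiN /expi cosN sinN; apply/eqP; rewrite eq_complex /=.
by rewrite mulrN opprK -!expr2 cos2Dsin2 mulrN mulrC addNr !eqxx.
Qed.

Theorem theorem6 (R : realType) (H : hilbertType R) (A : operator H)
    (A_sym : symmetric_11 A)
    (gp gm : hplus A)
    (gp_ker : ker_shift (adj A) 'i gp) (gm_ker : ker_shift (adj A) (- 'i) gm)
    (gp_norm : norm_plus gp = 1) (gm_norm : norm_plus gm = 1)
    (phi psi : hminus A)
    (phiE : riesz_berezansky phi = gp) (psiE : riesz_berezansky psi = gm)
    (alpha : R) (alpha_ge0 : 0 <= alpha) (alpha_ltpi : alpha < pi)
    (A_alpha : operator H) (A_alpha_sa : self_adjoint_ext A A_alpha)
    (A_alpha_dom : dom A_alpha ((gp : H) - expi (2 * alpha) *: (gm : H)))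
    (g : H) (g_ker : ker_shift (adj A) 'i g) (g_norm : `|g| = 1) :
  (exists2 Th : L_system A,
     unique (fun Th' : L_system A =>
       has_form_alpha0 alpha phi psi Th' /\
       (forall z : R[i], 0 < 'Im z ->
          impedance Th' z = weyl_titchmarsh A_alpha g z)) Th &
     [/\ quasi_kernel (bRe (state_op Th)) = A_alpha,
         vonNeumann_kappa gp gm (main_op Th) 0 &
         vonNeumann_U gp gm (quasi_kernel (bRe (state_op Th)))
           (- expi (2 * alpha))]) /\
  (forall Th : L_system A,
     quasi_kernel (bRe (state_op Th)) = A_alpha ->
     (forall z : R[i], 0 < 'Im z ->
        impedance Th z = weyl_titchmarsh A_alpha g z) ->
     vonNeumann_kappa gp gm (main_op Th) 0 /\
     vonNeumann_U gp gm (quasi_kernel (bRe (state_op Th)))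
       (- expi (2 * alpha))).
Proof.
have phiP f : pairing f phi = inner_plus f gp by exact: riesz_pairing.
have psiP f : pairing f psi = inner_plus f gm by exact: riesz_pairing.
set e := expi (2 * alpha) in A_alpha_dom *.
have e_unit : e * e^* = 1 by exact: expi_unit.
have A_alphaE := self_adjoint_ext_restriction A_sym gp_ker gm_ker gp_norm
  gm_norm e_unit A_alpha_sa A_alpha_dom.
have U_ok : vonNeumann_U (gp : H) (gm : H) A_alpha (- e).
  split; last by rewrite scaleNr.
  have : `|e| ^+ 2 = 1 by rewrite normCK.
  by move=> /eqP; rewrite sqrp_eq1 // normrN => /eqP.
have Re_sa : self_adjoint (restriction (fun f : hplus A =>
    inner_plus f gp + e^* * inner_plus f gm = 0)).
  by rewrite -A_alphaE; case: A_alpha_sa.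
have formE (Th : L_system A) : has_form_alpha0 alpha phi psi Th -> forall f,
    state_op Th f = emb A (Astar f) -
      ('i * pairing f psi) *: (e^* *: phi - psi).
  by move=> [SE _] f; rewrite SE expiN.
have mainE (Th : L_system A) :
    main_op Th `<=` restriction (fun f : hplus A => inner_plus f gm = 0) ->
    main_op Th = restriction (fun f : hplus A => inner_plus f gm = 0).
  exact: (main_operator_restriction A_sym gp_ker gm_ker gp_norm gm_norm
    (L_main Th)).
have imp (Th : L_system A) z : has_form_alpha0 alpha phi psi Th ->
    0 < 'Im z -> impedance Th z = weyl_titchmarsh A_alpha g z.
  move=> Th_form /Im_gt0_nreal z_nreal.
  apply: (impedance_chi A_sym gp_ker gm_ker gp_norm gm_norm phiP psiP e_unit)
    => //.
    by move=> f; apply: state_Re_chi => //; exact: formE.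
  by case: Th_form => _ ->; rewrite scale1r.
pose Th0 := system0 A_sym gp_ker gm_ker gp_norm gm_norm phiP psiP e_unit Re_sa.
have Th0_form : has_form_alpha0 alpha phi psi Th0.
  by split=> [f|//]; rewrite expiN.
have qk0 : quasi_kernel (bRe (state_op Th0)) = A_alpha.
  by rewrite A_alphaE; apply: state_Re_quasi_kernel => //; exact: formE.
split.
  exists Th0; last first.
    split; [exact: qk0| |by rewrite qk0].
    exact: (main_operator_kappa A_sym gp_ker gm_ker gp_norm gm_norm
      (L_main Th0)).
  split=> [|Th [Th_form _]]; first by split=> // z; exact: imp.
  apply: L_system_eq.
  (* The state-space operator determines the main operator: T lies in its quasi-kernel [cm = 0] and
     is non-symmetric, so it fills it. *)
  - suff : main_op Th `<=` restriction (fun f : hplus A => inner_plus f gm = 0).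
      by move=> /mainE ->.
    have [TS _ _ _ _] := L_state Th; apply: subset_trans TS _.
    rewrite (state_quasi_kernel A_sym gp_ker gm_ker gp_norm phiP psiP e_unit)
      //.
    exact: formE.
  - apply/val_inj/funext => f; rewrite /= formE //.
  - by apply: funext => c; case: Th_form => _ ->.
move=> Th qkTh impTh; split; last by rewrite qkTh.
apply: (main_operator_kappa A_sym gp_ker gm_ker gp_norm gm_norm (L_main Th)).
apply: (state_determined A_sym gp_ker gm_ker gp_norm e_unit).
  by rewrite qkTh.
have Im_i : 0 < 'Im ('i : R[i]) by rewrite Im_i ltr01.
(* At z = i the factor z^2 + 1 vanishes, so M(i) = i. *)
have [r [_ _]] := weyl_titchmarshE A_sym gp_ker gm_ker gp_norm gm_norm e_unit
  A_alpha_sa A_alpha_dom g_norm (Im_gt0_nreal Im_i).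
by rewrite impTh // => ->; rewrite sqrCi addNr mul0r addr0.
Qed.
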